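(* Let $\mathcal{H}$ be a Hilbert space and let $f:(0,\infty)\to(0,\infty)$ be a continuous function. Then $f$ is operator log-convex if and only if the set $$\mathcal{K}=\{(X,Y)\in\mathcal{B}(\mathcal{H})^+\times\mathcal{B}(\mathcal{H})^+;\ f(X^{-1})\leq Y\}$$ is a $C^*$-log-convex set.
   Context: $\mathcal{H}$ is a fixed Hilbert space and $\mathcal{B}(\mathcal{H})$ is the $C^*$-algebra of all bounded linear operators on $\mathcal{H}$, with identity $I$. An operator $X\in\mathcal{B}(\mathcal{H})$ is positive ($X\geq 0$) if $\langle Xa,a\rangle\geq 0$ for every $a\in\mathcal{H}$; it is strictly positive ($X>0$) if in addition it is invertible. $\mathcal{B}(\mathcal{H})^+$ denotes the set of all strictly positive operators on $\mathcal{H}$. $A\leq B$ means $B-A\geq 0$. For $X>0$, $f(X)$ is defined by the continuous functional calculus. For strictly positive operators $X,Y$ the geometric mean is $X\sharp Y=X^{1/2}\left(X^{-1/2}YX^{-1/2}\right)^{1/2}X^{1/2}$. A continuous function $f:(0,\infty)\to(0,\infty)$ is operator log-convex if $f\left(\frac{X+Y}{2}\right)\leq f(X)\sharp f(Y)$ for all strictly positive operators $X,Y$. A set $\mathcal{K}\subseteq\mathcal{B}(\mathcal{H})\times\mathcal{B}(\mathcal{H})$ is $C^*$-log-convex if $(X_1,Y_1),\dots,(X_n,Y_n)\in\mathcal{K}$ and $C_1,\dots,C_n\in\mathcal{B}(\mathcal{H})$ with $\sum_{i=1}^n C_i^*C_i=I$ (any $n\in\mathbb{N}$) imply $$\left(\left(\sum_{i=1}^{n}C_i^*X_i^{-1}C_i\right)^{-1},\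 \left(\sum_{i=1}^{n}C_i^*Y_i^{-1}C_i\right)^{-1}\right)\in\mathcal{K}.$$
   Formalization: The Hilbert space is assumed infinite-dimensional for the direction from operator log-convexity of f to C*-log-convexity of K, which fails for H = ℂ and f = exp; the other direction is stated for every Hilbert space. *)

(* Defs.v *)
From HB Require Import structures.
From mathcomp Require Import all_boot all_order all_algebra.
From mathcomp Require Import complex.
From mathcomp Require Import all_classical all_reals all_analysis.

Set Implicit Arguments.
Unset Strict Implicit.
Unset Printing Implicit Defensive.

Import Order.TTheory GRing.Theory Num.Theory.
Import numFieldNormedType.Exports.

Local Open Scope classical_set_scope.
Local Open Scope ring_scope.
Local Open Scope complex_scope.

(* Complex Hilbert spaces; the inner product is linear in its first argument. *)
HB.mixin Record CompleteNormedModule_isHilbert (R : realType) H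
    of CompleteNormedModule R[i] H := {
  inner : {dot H for @Num.conj R[i]} ;
  innerE : forall x : H, inner x x = `|x| ^+ 2
}.

#[short(type="hilbertType")]
HB.structure Definition Hilbert (R : realType) :=
  {H of CompleteNormedModule R[i] H & CompleteNormedModule_isHilbert R H}.

(* On a space of finite dimension operator log-convexity need not imply
   C*-log-convexity of the set Kset below: on H = C, with f = exp, the former
   is the log-convexity of exp, the latter would be the concavity of 1 / exp. *)
Definition infinite_dimensional (R : realType) (H : hilbertType R) : Prop :=
  forall (n : nat) (e : 'I_n -> H),
    exists x : H, forall c : 'I_n -> R[i], x <> \sum_(i < n) c i *: e i.

Section BoundedOperators.
Context {R : realType} (H : hilbertType R).

Definition bounded_linear : {pred H -> H} := fun f =>
  `[< linear f /\ exists M : R, forall x, `|f x| <= M%:C * `|x| >].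

Record bop := Bop { bop_fun :> H -> H ; _ : bop_fun \in bounded_linear }.

HB.instance Definition _ := [isSub for bop_fun].
HB.instance Definition _ := [Choice of bop by <:].

Lemma bounded_linear_submod_closed : submod_closed bounded_linear.
Proof.
split=> [|a f g /asboolP[lf [M fM]] /asboolP[lg [N gN]]]; apply/asboolP; split.
- by move=> b x y; rewrite /= scaler0 addr0.
- by exists 0 => x; rewrite normr0 mul0r.
- move=> b x y; rewrite /= !fctE lf lg.
  by rewrite !scalerDr !scalerA [b * a]mulrC addrACA.
- exists (Normc.normc a * M + N) => x; rewrite !fctE.
  apply: (le_trans (ler_normD _ _)).
  rewrite normrZ rmorphD rmorphM/= mulrDl.
  by rewrite lerD// -mulrA ler_wpM2l.
Qed.

HB.instance Definition _ :=
  GRing.isSubmodClosed.Build _ _ bounded_linear bounded_linear_submod_closed.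
HB.instance Definition _ := [SubChoice_isSubLmodule of bop by <:].


Lemma bopP (X Y : bop) : (forall x, X x = Y x) -> X = Y.
Proof. by move=> XY; apply/val_inj/funext. Qed.

Lemma bounded_linear_id : idfun \in bounded_linear.
Proof. by apply/asboolP; split=> //; exists 1 => x; rewrite mul1r. Qed.

Lemma bounded_linear_comp (X Y : bop) : X \o Y \in bounded_linear.
Proof.
have /asboolP[lf [M fM]] := valP X; have /asboolP[lg [N gN]] := valP Y.
apply/asboolP; split=> [a u v|]; first by rewrite /= lg lf.
exists (`|M| * N) => x /=; apply: (le_trans (fM _)).
rewrite rmorphM/= -mulrA (@le_trans _ _ (`|M|%:C * `|Y x|))//.
  by rewrite ler_wpM2r// lecR ler_norm.
by rewrite ler_wpM2l// ?gN// lecR.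
Qed.

Definition bop_one : bop := Bop bounded_linear_id.
Definition bop_mul (X Y : bop) : bop := Bop (bounded_linear_comp X Y).

Lemma bop_mulA : associative bop_mul. Proof. by move=> *; apply: bopP. Qed.
Lemma bop_mul1X : left_id bop_one bop_mul. Proof. by move=> *; apply: bopP. Qed.
Lemma bop_mulX1 : right_id bop_one bop_mul. Proof. by move=> *; apply: bopP. Qed.
Lemma bop_mulDl : left_distributive bop_mul +%R.
Proof. by move=> X Y Z; apply: bopP. Qed.
Lemma bop_mulDr : right_distributive bop_mul +%R.
Proof.
move=> X Y Z; apply: bopP => x /=; have /asboolP[lX _] := valP X.
by rewrite !fctE -[Y x]scale1r lX !scale1r.
Qed.

(* B(H) is only a pzRingType (product = composition): H may be {0}, in which
   case 1 = 0. *)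
HB.instance Definition _ := GRing.Zmodule_isPzRing.Build bop
  bop_mulA bop_mul1X bop_mulX1 bop_mulDl bop_mulDr.

End BoundedOperators.

Section Operators.
Context {R : realType} {H : hilbertType R}.
Implicit Types (X Y C : bop H) (f : R -> R).

(* [adjoint] and [opinv] are total: their default value is reached only where
   the adjoint, resp. the inverse, does not exist. *)
Definition adjoint X : bop H :=
  xget 0 [set Y : bop H | forall a b, inner (X a) b = inner a (Y b)].

Definition invertible X : Prop := exists Y, X * Y = 1 /\ Y * X = 1.

Definition opinv X : bop H := xget 0 [set Y : bop H | X * Y = 1 /\ Y * X = 1].

(* The order of R[i] makes 0 <= z mean that z is a nonnegative real. *)
Definition op_ge0 X : Prop := forall a : H, 0 <= inner (X a) a.

Definition op_le X Y : Prop := op_ge0 (Y - X).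

Definition op_gt0 X : Prop := op_ge0 X /\ invertible X.

Definition spectrum X : set R[i] := [set z | ~ invertible (X - z *: (1 : bop H))].

Definition poly_op (p : {poly R}) X : bop H :=
  \sum_(i < size p) (p`_i)%:C *: X ^+ i.

(* Convergence of u to Y in operator norm: |u n - Y| <= e, eventually. *)
Definition op_cvg (u : nat -> bop H) Y : Prop :=
  forall e : R, 0 < e ->
    \forall n \near \oo, forall a : H, `|(u n - Y) a| <= e%:C * `|a|.

(* The continuous functional calculus of a self-adjoint X: f(X) is the norm
   limit of p_n(X), where the real polynomials p_n converge to f uniformly on
   the (real) spectrum of X. Only the values of f on the spectrum matter; for a
   strictly positive X it is a compact subset of ]0, +oo[. *)
Definition is_cfc f X Y : Prop :=
  exists p : nat -> {poly R},
    (forall e : R, 0 < e -> \forall n \near \oo,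
       forall t : R, spectrum X t%:C -> `|(p n).[t] - f t| <= e) /\
    op_cvg (fun n => poly_op (p n) X) Y.

Definition cfc f X : bop H := xget 0 [set Y : bop H | is_cfc f X Y].

Definition gmean X Y : bop H :=
  let S := cfc Num.sqrt X in
  let T := opinv S in
  S * cfc Num.sqrt (T * Y * T) * S.

Definition cstar_log_convex (K : set (bop H * bop H)) : Prop :=
  forall (n : nat) (X Y C : 'I_n -> bop H),
    (forall i, K (X i, Y i)) ->
    \sum_(i < n) adjoint (C i) * C i = 1 ->
    K (opinv (\sum_(i < n) adjoint (C i) * opinv (X i) * C i),
       opinv (\sum_(i < n) adjoint (C i) * opinv (Y i) * C i)).

Definition Kset f : set (bop H * bop H) :=
  [set XY | [/\ op_gt0 XY.1, op_gt0 XY.2 & op_le (cfc f (opinv XY.1)) XY.2]].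

End Operators.

Definition operator_log_convex (R : realType) (H : hilbertType R)
    (f : R -> R) : Prop :=
  forall X Y : bop H, op_gt0 X -> op_gt0 Y ->
    op_le (cfc f (2^-1 *: (X + Y))) (gmean (cfc f X) (cfc f Y)).

(* Main.v *)
From HB Require Import structures.
Require Import Defs.
From mathcomp Require Import all_boot all_order all_algebra.
From mathcomp Require Import complex.
From mathcomp Require Import all_classical all_reals all_analysis.
From mathcomp Require Import ring lra.
Import Order.TTheory GRing.Theory Num.Theory.
Import numFieldNormedType.Exports.

Set Implicit Arguments.
Unset Strict Implicit.
Unset Printing Implicit Defensive.

Local Open Scope classical_set_scope.
Local Open Scope ring_scope.
Local Open Scope complex_scope.

(* Put h = 1/f. Passing to inverses, C*-log-convexity of the set says that h
   satisfies Jensen's operator inequality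
     sum_i C_i^* h(A_i) C_i <= h (sum_i C_i^* A_i C_i).
   The case of two scalar C_i gives f((X+Y)/2) <= the harmonic mean of f(X) and
   f(Y), which is at most their geometric mean.

   Conversely let f be operator log-convex. The inequality applied to the
   perturbations a + t uu^* and a + t u'u'^* of the scalar a by two rank-one
   projections gives f(b)^2 d <= (b + d - a) f(a) max(f(a), f(b + d)), and this
   forces f(b) <= 8 f(a) whenever a <= b. Being operator convex and bounded at
   infinity, f is operator decreasing (Hansen's trick: l B is a convex
   combination of A and a large multiple of B - A), so that h is operator
   increasing. Jensen's inequality follows by comparing a dilation of the A_i to
   its compression plus a large multiple of the complementary projection. Since
   h is a uniform limit of polynomials on compact intervals, testing the
   inequality at a vector x only involves finitely many vectors, so that a
   finite-rank dilation suffices; it exists inside H because H is infinite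
   dimensional. *)

(** * Uniform polynomial approximation *)

(** Operator convexity alone cannot give monotonicity, as t^2 shows. What log-convexity adds is the
    off-diagonal bound <(P # Q) x, y>^2 <= <P x, x> <Q y, y>, and the growth inequality comes from
    testing it on eigenvectors. The value 8 is immaterial: what counts is that f is bounded on every
    ray [e, +oo[. The monotonicity so obtained asks for a gap A + e <= B, since the large multiple
    of B - A must be strictly positive. The dilation therefore has to lie below its comparison
    operator with room to spare; this is why the compression is first multiplied by 1 + e, a factor
    removed at the end by continuity under scaling. The usual dilation lives on a sum of n copies of
    H. Here the copies must fit inside H, so only finitely many vectors are copied: those that an
    approximating polynomial of the operators can reach from the vector at which the inequality is
    tested. *)

Section RealAnalysis.
Context {R : realType}.
Implicit Types (f : R -> R) (a b : R).

(** The error term is a square because the binomial average of a square is a variance, known in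
    closed form. Close points are handled by continuity, distant ones by taking [K] large against
    the bound of [f]. *)
Lemma continuous_segment_quad f a b : a <= b ->
  {within `[a, b], continuous f} ->
  forall e, 0 < e -> exists2 K, 0 <= K & forall s t,
    a <= s <= b -> a <= t <= b -> `|f s - f t| <= e + K * (s - t) ^+ 2.
Proof.
move=> ab fc e e0.
have [M M0 fM] : exists2 M, 0 <= M & forall t, a <= t <= b -> `|f t| <= M.
  have [u _ fu] := EVT_max ab fc; have [v _ fv] := EVT_min ab fc.
  exists (`|f u| + `|f v|) => [|t tab]; first by rewrite addr_ge0.
  have {}tab : t \in `[a, b] by rewrite in_itv.
  have := fu t tab; have := fv t tab.
  have := ler_norm (f u); have := ler_norm (- f v); rewrite normrN => *.
  rewrite ler_norml; have := normr_ge0 (f u); have := normr_ge0 (f v) => *.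
  by apply/andP; split; lra.
(* The estimate holds for [s] near each point and all large [K]; compactness makes one [K] serve the
   whole segment. *)
have : near_covering `[a, b]%classic.
  by apply/compact_near_coveringP; apply: segment_compact.
move=> /(_ R +oo%R (fun K s => a <= s <= b -> forall t, a <= t <= b ->
   `|f s - f t| <= e + K * (s - t) ^+ 2) _).
case=> [x|K0 [K0r HK]].
  rewrite /= in_itv/= => xab.
  have /subspace_continuousP/(_ x) := fc.
  rewrite /= in_itv/= => /(_ xab)/cvgrPdist_le/(_ (e / 2)).
  rewrite divr_gt0// => /(_ isT).
  rewrite near_withinE => /nbhs_ballP[d /= d0 Hd].
  have {}Hd t : a <= t <= b -> `|x - t| < d -> `|f x - f t| <= e / 2.
    by move=> tab xt; apply: Hd => //=; rewrite in_itv.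
  near=> s K => /= sab t tab.
  have K0 : 0 <= K by near: K; exact: nbhs_pinfty_ge.
  have [xt|xt] := ltP `|x - t| d.
    have xs : `|x - s| < d.
      near: s; apply/nbhs_ballP; exists d => // ?.
    have := Hd _ tab xt; have := Hd _ sab xs.
    rewrite !ler_norml => /andP[? ?] /andP[? ?].
    have : 0 <= K * (s - t) ^+ 2 by rewrite mulr_ge0// sqr_ge0.
    by move=> ?; apply/andP; split; lra.
  have xs : `|x - s| < d / 2.
    near: s; apply/nbhs_ballP; exists (d / 2); rewrite /= ?divr_gt0// => ?.
  have st : (d / 2) ^+ 2 <= (s - t) ^+ 2.
    rewrite -(real_normK (num_real (s - t))) lerXn2r// ?nnegrE ?divr_ge0 ?ltW//.
    have := ler_distD s x t; move: xs xt; lra.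
  have KM : 2 * M / (d / 2) ^+ 2 <= K.
    by near: K; apply: nbhs_pinfty_ge; rewrite num_real.
  have : 2 * M <= K * (s - t) ^+ 2.
    apply: (@le_trans _ _ (K * (d / 2) ^+ 2)); last by rewrite ler_wpM2l.
    by rewrite -ler_pdivrMr// exprn_gt0// divr_gt0.
  have := fM _ sab; have := fM _ tab; have := ler_normB (f s) (f t).
  lra.
exists (`|K0| + 1); first by rewrite addr_ge0.
move=> s t sab tab; have K01 : K0 < `|K0| + 1.
  by rewrite (le_lt_trans (ler_norm K0))// ltrDl.
by apply: (HK _ K01) => //; rewrite /= in_itv.
Unshelve. all: by end_near.
Qed.

(* [bernstein n g] is the polynomial in [x] whose value is the expectation of
   [g] under the binomial law with parameters [n] and [x]. *)
Fixpoint bernstein (n : nat) (g : nat -> R) : {poly R} :=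
  if n is n'.+1 then
    (1 - 'X) * bernstein n' g + 'X * bernstein n' (fun k => g k.+1)
  else (g 0%N)%:P.

(** The centre [y] is left arbitrary, since the second branch of the recursion replaces [k] by
    [k.+1], hence [y] by [y - 1]. *)
Lemma bernstein_variance n (y x : R) :
  (bernstein n (fun k => (k%:R - y) ^+ 2)).[x] =
    (n%:R * x - y) ^+ 2 + n%:R * x * (1 - x).
Proof.
elim: n y => [|n IH] y; first by rewrite /= !hornerE; ring.
rewrite /= !hornerE IH.
under [X in bernstein n X]funext => k.
  rewrite -natr1 -addrA -[1 - y]opprB; over.
by rewrite IH -natr1; ring.
Qed.

(** For [x] in [0, 1] each step of the recursion is a convex combination, so pointwise bounds pass
    to the average. *)
Lemma bernstein_dist_le n (g : nat -> R) (x c e K y : R) : 0 <= x <= 1 ->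
  (forall k, `|g k - c| <= e + K * (k%:R - y) ^+ 2) ->
  `|(bernstein n g).[x] - c|
    <= e + K * (bernstein n (fun k => (k%:R - y) ^+ 2)).[x].
Proof.
move=> x01; rewrite bernstein_variance.
elim: n g y => [|n IH] g y gP; first by have := gP 0%N; rewrite /= !hornerE; lra.
rewrite /= !hornerE.
have {}gP1 k : `|g k.+1 - c| <= e + K * (k%:R - (y - 1)) ^+ 2.
  by have := gP k.+1; rewrite -natr1 opprB addrA addrAC.
have := IH _ _ gP; have := IH _ _ gP1; rewrite !ler_norml -!natr1.
set u := (bernstein _ _).[_]; set v := (bernstein _ _).[_].
move=> /andP[u1 u2] /andP[v1 v2]; case/andP: x01 => x0 x1.
have x1' : 0 <= 1 - x by lra.
have := ler_wpM2l x0 u1; have := ler_wpM2l x0 u2.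
have := ler_wpM2l x1' v1; have := ler_wpM2l x1' v2.
by move=> *; apply/andP; split; nra.
Qed.

Lemma weierstrass f a b : a <= b -> {within `[a, b], continuous f} ->
  forall e, 0 < e -> exists p : {poly R},
    forall t, a <= t <= b -> `|p.[t] - f t| <= e.
Proof.
move=> ab fc e e0; have e20 : 0 < e / 2 by rewrite divr_gt0.
have [K K0 HK] := continuous_segment_quad ab fc e20.
have [->|anb] := eqVneq a b.
  exists (f b)%:P => t; rewrite hornerC => /andP[bt tb].
  by have -> : t = b by [lra|]; rewrite subrr normr0 ltW.
have ltab : a < b by rewrite lt_neqAle anb.
set l := b - a; have l0 : 0 < l by rewrite subr_gt0.
(* The variance contributes [K * l ^+ 2 / n%:R] times [x * (1 - x)]; the first factor is now at most
   [e], the second at most 1 / 2. *)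
have [n n0 nK] : exists2 n, (0 : R) < n%:R & K * l ^+ 2 / e < n%:R.
  by exists (Num.truncn (K * l ^+ 2 / e)).+1; rewrite ?ltr0n ?truncnS_gt.
(* [bernstein_dist_le] wants its bound at every natural [k], even beyond [n]; clamping extends [f]
   by constants without increasing distances. *)
pose clamp (t : R) := Num.max a (Num.min b t).
have clampP t : a <= clamp t <= b by rewrite /clamp le_max ge_max ge_min !lexx ab.
have clamp_id t : a <= t <= b -> clamp t = t.
  by move=> /andP[h1 h2]; rewrite /clamp min_r// max_r.
have clampB s t : (clamp s - clamp t) ^+ 2 <= (s - t) ^+ 2.
  rewrite -(real_normK (num_real (s - t))) -[leLHS](real_normK (num_real _)).
  rewrite lerXn2r ?nnegrE//.
  clear -ab; have := ler_norm (s - t); have := ler_norm (t - s).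
  rewrite (distrC t s) /clamp.
  by do ?[case: (leP b _) => ?]; do ?[case: (leP a _) => ?]; move=> *;
    rewrite ler_norml; apply/andP; split; lra.
pose g (k : nat) := f (clamp (a + l * (k%:R / n%:R))).
exists (bernstein n g \Po (l^-1 *: ('X - a%:P))) => t tab.
rewrite horner_comp !hornerE; set x := l^-1 * (t - a).
have x01 : 0 <= x <= 1.
  rewrite /x mulrC divr_ge0//= ?ler_pdivrMr ?mul1r// ?(ltW l0)//;
  rewrite /l; lra.
have txE : t = a + l * x by rewrite /x mulrA divff ?gt_eqF// mul1r addrC subrK.
have gP k : `|g k - f t| <= e / 2 + (K * l ^+ 2 / n%:R ^+ 2) * (k%:R - n%:R * x) ^+ 2.
  apply: (le_trans (HK _ _ _ _)) => //.
  rewrite lerD2l -(clamp_id t)// (le_trans (ler_wpM2l K0 (clampB _ _)))//.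
  rewrite le_eqVlt; apply/orP; left; apply/eqP; rewrite txE; field.
  by rewrite gt_eqF.
apply: (le_trans (bernstein_dist_le n x01 gP)).
rewrite bernstein_variance subrr expr0n/= add0r.
have -> : K * l ^+ 2 / n%:R ^+ 2 * (n%:R * x * (1 - x)) =
    (K * l ^+ 2) / n%:R * (x * (1 - x)) by field; rewrite gt_eqF.
have h1 : K * l ^+ 2 / n%:R <= e.
  by rewrite ler_pdivrMr// [e * _]mulrC -ler_pdivrMr// ltW.
have h2 : x * (1 - x) <= 1 / 2 by case/andP: x01 => *; nra.
have h3 : 0 <= x * (1 - x) by rewrite mulr_ge0//; lra.
have h4 : 0 <= K * l ^+ 2 / n%:R.
  by apply: divr_ge0; [apply: mulr_ge0 => //; apply: sqr_ge0|apply: ltW].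
have := ler_pM h4 h3 h1 h2.
lra.
Qed.

End RealAnalysis.

(** * A growth inequality that forces boundedness *)

Section Growth.
Context {R : realType}.
Implicit Types (f : R -> R) (a b : R).

(* The maximum of [(a + T - x) * max (f a) (f x)] over [a <= x <= a + T]
   turns the quadratic growth inequality into a bound. *)
Lemma quadratic_growth_bounded f :
  (forall x, 0 < x -> 0 < f x) ->
  {within `]0, +oo[, continuous f} ->
  (forall a b d, 0 < a -> a < b -> 0 < d ->
     f b ^+ 2 * d <= (b + d - a) * f a * Num.max (f a) (f (b + d))) ->
  forall a b, 0 < a -> a <= b -> f b <= 8 * f a.
Proof.
move=> f0 fc H a b a0; rewrite le_eqVlt => /predU1P[<-|ab].
  by have := f0 _ a0; lra.
(* This makes [b] the midpoint of [a, a + T]: a maximum of at most [4 * T * f a] then yields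
   [G b <= 8 * f a]. *)
set T := 2 * (b - a).
pose G x := Num.max (f a) (f x).
have T0 : 0 < T by rewrite /T; lra.
have fa0 := f0 _ a0.
have Gc : {within `[a, a + T], continuous (fun x => (a + T - x) * G x)}.
  have fc' : {within `[a, a + T], continuous f}.
    apply: continuous_subspaceW fc => x /=; rewrite !in_itv/= andbT.
    by move=> /andP[+ _]; apply: lt_le_trans.
  have idc : {within `[a, a + T], continuous (@idfun R)}.
    by apply: continuous_subspaceT => y; exact: cvg_id.
  move=> x; apply: cvgM.
    apply: cvgB; first exact: cvg_cst.
    exact: idc.
  by apply: continuous_max; [exact: cvg_cst|exact: fc'].
have aT : a <= a + T by lra.
have [c] := EVT_max aT Gc.
rewrite in_itv/= => /andP[ac cT] Hc.
have GaE : G a = f a by rewrite /G maxxx.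
have Gge x : f a <= G x by rewrite /G le_max lexx.
set D := a + T - c; have D0 : 0 <= D by rewrite /D; lra.
have bin : b \in `[a, a + T] by rewrite in_itv/= /T; apply/andP; split; lra.
have Hb : T / 2 * G b <= D * G c.
  by have := Hc b bin; rewrite (_ : a + T - b = T / 2)//; rewrite /T; lra.
suff : D * G c <= 4 * T * f a.
  have : f b <= G b by rewrite /G le_max lexx orbT.
  by move=> h1 h2; have := le_trans Hb h2; nra.
have [cE|c_neq] := eqVneq c a.
  by rewrite /D cE GaE (_ : a + T - a = T); [nra|lra].
have [D_eq0|Dn0] := eqVneq D 0.
  by rewrite D_eq0 mul0r; apply: mulr_ge0; [lra|exact: ltW].
have Dpos : 0 < D by rewrite lt_neqAle eq_sym Dn0.
have {}ac : a < c by rewrite lt_neqAle eq_sym c_neq.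
(* Halfway between [c] and [a + T], maximality gives [G <= 2 * G c]; the hypothesis at [c] with
   [d := D / 2] then becomes [G c ^+ 2 * (D / 2) <= T * f a * (2 * G c)]. *)
have cDin : c + D / 2 \in `[a, a + T].
  by rewrite in_itv/=; apply/andP; split; rewrite /D; lra.
have := Hc _ cDin; rewrite -/D (_ : a + T - (c + D / 2) = D / 2);
  last by rewrite /D; lra.
move=> HD.
have GD : G (c + D / 2) <= 2 * G c.
  have : D * (G (c + D / 2) - 2 * G c) <= 0 by lra.
  by rewrite pmulr_rle0//; lra.
have Gc0 : 0 < G c by rewrite (lt_le_trans fa0).
have GcD : G c ^+ 2 * (D / 2) <= T * f a * G (c + D / 2).
  have [fca|fac] := leP (f c) (f a).
    have -> : G c = f a by rewrite /G max_l.
    have := Gge (c + D / 2) => h.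
    have h1 : f a * f a <= f a * G (c + D / 2) by rewrite ler_pM2l.
    have h2 : D / 2 <= T by rewrite /D; lra.
    have : D / 2 * (f a * f a) <= T * (f a * G (c + D / 2)).
      by apply: ler_pM => //; [lra|rewrite mulr_ge0// ltW].
    by rewrite expr2; lra.
  have -> : G c = f c by rewrite /G max_r// ltW.
  have D20 : 0 < D / 2 by rewrite divr_gt0.
  apply: (le_trans (H _ _ _ a0 ac D20)).
  rewrite -/(G _) ler_wpM2r ?(le_trans _ (Gge _)) ?(ltW fa0)//.
  by rewrite ler_wpM2r ?(ltW fa0)// /D; lra.
have : G c ^+ 2 * (D / 2) <= T * f a * (2 * G c).
  by apply: (le_trans GcD); rewrite ler_wpM2l// mulr_ge0// ltW.
have -> : G c ^+ 2 * (D / 2) = G c * (D * G c / 2) by field.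
have -> : T * f a * (2 * G c) = G c * (2 * T * f a) by ring.
by rewrite ler_pM2l//; lra.
Qed.

End Growth.

(** * Operators through the real inner product *)

Section RealInnerProduct.
Context {R : realType} {H : hilbertType R}.
Implicit Types (x y z : H) (a b c : R) (k : R[i]).

(** The real part loses nothing, as [rip x ('i *: y)] is the imaginary part of [inner x y], and it
    keeps all inequalities over [R]. *)
Definition rip x y : R := complex.Re (inner x y).
Definition nrm x : R := Num.sqrt (rip x x).

Lemma innerC x y : inner x y = (inner y x)^*.
Proof. by rewrite hermC/= expr0 mul1r. Qed.

Lemma innerDl x y z : inner (x + y) z = inner x z + inner y z.
Proof. exact: linearDl. Qed.
Lemma innerDr x y z : inner z (x + y) = inner z x + inner z y.
Proof. exact: linearDr. Qed.
Lemma innerZl k x y : inner (k *: x) y = k * inner x y.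
Proof. exact: linearZl_LR. Qed.
Lemma innerZr k x y : inner x (k *: y) = k^* * inner x y.
Proof. exact: linearZr_LR. Qed.

Lemma ripC x y : rip x y = rip y x.
Proof. by rewrite /rip innerC; case: (inner y x). Qed.
Lemma ripDl x y z : rip (x + y) z = rip x z + rip y z.
Proof. by rewrite /rip innerDl raddfD. Qed.
Lemma ripDr x y z : rip z (x + y) = rip z x + rip z y.
Proof. by rewrite ripC ripDl !(ripC z). Qed.
Lemma ripNl x z : rip (- x) z = - rip x z.
Proof. by rewrite -scaleN1r /rip innerZl mulN1r raddfN. Qed.
Lemma ripNr x z : rip z (- x) = - rip z x.
Proof. by rewrite ripC ripNl (ripC z). Qed.
Lemma ripBl x y z : rip (x - y) z = rip x z - rip y z.
Proof. by rewrite ripDl ripNl. Qed.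
Lemma ripBr x y z : rip z (x - y) = rip z x - rip z y.
Proof. by rewrite ripDr ripNr. Qed.
Lemma ripZl c x y : rip (c%:C *: x) y = c * rip x y.
Proof.
by rewrite /rip innerZl; case: (inner x y) => u v; simpc.
Qed.
Lemma ripZr c x y : rip x (c%:C *: y) = c * rip x y.
Proof. by rewrite ripC ripZl ripC. Qed.
Lemma rip0l x : rip 0 x = 0.
Proof. by rewrite -[0](scale0r x) /rip innerZl mul0r. Qed.
Lemma rip0r x : rip x 0 = 0.
Proof. by rewrite ripC rip0l. Qed.
Lemma rip_suml (I : Type) (r : seq I) (P : pred I) (F : I -> H) z :
  rip (\sum_(i <- r | P i) F i) z = \sum_(i <- r | P i) rip (F i) z.
Proof.
by elim/big_rec2: _ => [|i u v _ <-]; rewrite ?rip0l ?ripDl.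
Qed.
Lemma ripi x y : rip x ('i *: y) = complex.Im (inner x y).
Proof.
by rewrite /rip innerZr; case: (inner x y) => u v /=; lra.
Qed.

Lemma innerE_rip x y : inner x y = rip x y +i* rip x ('i *: y).
Proof. by rewrite ripi /rip; case: (inner x y). Qed.

Lemma innerxx x : inner x x = (rip x x)%:C.
Proof.
have : 0 <= inner x x by rewrite innerE exprn_ge0.
by rewrite /rip lecE/= => /andP[/eqP]; case: (inner x x) => u v /= ->.
Qed.

Lemma ripxx_ge0 x : 0 <= rip x x.
Proof. by rewrite -ler0c -innerxx innerE exprn_ge0. Qed.

Lemma nrm_ge0 x : 0 <= nrm x. Proof. exact: sqrtr_ge0. Qed.
Lemma nrm_sqr x : nrm x ^+ 2 = rip x x.
Proof. by rewrite sqr_sqrtr// ripxx_ge0. Qed.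

Lemma normE x : `|x| = (nrm x)%:C.
Proof.
have: `|x| ^+ 2 = (nrm x)%:C ^+ 2.
  by rewrite -innerE innerxx -nrm_sqr rmorphXn.
move=> /eqP; rewrite eqrXn2// ?ler0c ?nrm_ge0// => /eqP//.
Qed.

Lemma ripxx_eq0 x : rip x x = 0 -> x = 0.
Proof.
by move=> x0; apply/eqP; rewrite -normr_eq0 normE /nrm x0 sqrtr0.
Qed.

Lemma nrm0 : nrm 0 = 0 :> R. Proof. by rewrite /nrm rip0l sqrtr0. Qed.

Lemma ler_nrmD x y : nrm (x + y) <= nrm x + nrm y.
Proof. by rewrite -lecR rmorphD/= -!normE ler_normD. Qed.

Lemma nrmZC k x : nrm (k *: x) = Normc.normc k * nrm x.
Proof. by apply: complexI; rewrite rmorphM/= -!normE normrZ. Qed.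

Lemma nrmZ c x : nrm (c%:C *: x) = `|c| * nrm x.
Proof. by rewrite nrmZC /= expr0n/= addr0 sqrtr_sqr. Qed.

Lemma nrmN x : nrm (- x) = nrm x.
Proof. by rewrite /nrm ripNl ripNr opprK. Qed.

Lemma ripB2 x y : rip (x - y) (x - y) = rip x x + rip y y - 2 * rip x y.
Proof. by rewrite ripBl !ripBr (ripC y x); ring. Qed.

Lemma rip_le_nrm x y : rip x y <= nrm x * nrm y.
Proof.
have := nrm_sqr x; have := nrm_sqr y; have := nrm_ge0 x; have := nrm_ge0 y.
set s := nrm x; set t := nrm y => t0 s0 tE sE.
have : 0 <= rip (t%:C *: x - s%:C *: y) (t%:C *: x - s%:C *: y).
  exact: ripxx_ge0.
rewrite ripB2 !ripZl !ripZr -tE -sE => h.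
have [st0|st0] := eqVneq (s * t) 0.
  move: st0 => /eqP; rewrite mulf_eq0 => /orP[] /eqP z0.
    have -> : x = 0 by apply: ripxx_eq0; rewrite -sE z0 expr0n.
    by rewrite rip0l mulr_ge0.
  have -> : y = 0 by apply: ripxx_eq0; rewrite -tE z0 expr0n.
  by rewrite rip0r mulr_ge0.
have {}st0 : 0 < s * t by rewrite lt_neqAle eq_sym st0 mulr_ge0.
rewrite -(ler_pM2l st0); move: h; rewrite !expr2; lra.
Qed.

End RealInnerProduct.

HB.instance Definition _ (R : realType) (H : hilbertType R) (X : bop H) :=
  GRing.isLinear.Build R[i] H H *:%R X (asboolW (valP X)).1.

Section BopBasics.
Context {R : realType} {H : hilbertType R}.
Implicit Types (x y z : H) (a b c m M : R) (k : R[i]) (X Y Z : bop H).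

Lemma bopDE X Y x : (X + Y) x = X x + Y x. Proof. by []. Qed.
Lemma bopNE X x : (- X) x = - X x. Proof. by []. Qed.
Lemma bopBE X Y x : (X - Y) x = X x - Y x. Proof. by []. Qed.
Lemma bopME X Y x : (X * Y) x = X (Y x). Proof. by []. Qed.
Lemma bop1E x : (1 : bop H) x = x. Proof. by []. Qed.
Lemma bop0E x : (0 : bop H) x = 0. Proof. by []. Qed.
Lemma bopZE k X x : (k *: X) x = k *: X x. Proof. by []. Qed.
Lemma bop_sumE (I : Type) (r : seq I) (P : pred I) (F : I -> bop H) x :
  (\sum_(i <- r | P i) F i) x = \sum_(i <- r | P i) F i x.
Proof. by elim/big_rec2: _ => // i u v _ <-. Qed.

Definition bopE := (bopDE, bopNE, bopBE, bopME, bop1E, bop0E, bopZE, bop_sumE).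

Lemma bop_linD X x y : X (x + y) = X x + X y. Proof. exact: linearD. Qed.
Lemma bop_linB X x y : X (x - y) = X x - X y. Proof. exact: linearB. Qed.
Lemma bop_linZ X k x : X (k *: x) = k *: X x. Proof. exact: linearZ. Qed.
Lemma bop_lin0 X : X 0 = 0. Proof. exact: linear0. Qed.
Lemma bop_lin_sum X (I : Type) (r : seq I) (P : pred I) (F : I -> H) :
  X (\sum_(i <- r | P i) F i) = \sum_(i <- r | P i) X (F i).
Proof. exact: linear_sum. Qed.

Lemma scale_bopAl k X Y : (k *: X) * Y = k *: (X * Y).
Proof. exact: bopP. Qed.
Lemma scale_bopAr k X Y : X * (k *: Y) = k *: (X * Y).
Proof. by apply: bopP => x; rewrite !bopE linearZ. Qed.

Definition bop_bound X c := forall x, nrm (X x) <= c * nrm x.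

Lemma bop_boundP X c : bop_bound X c <-> forall x, `|X x| <= c%:C * `|x|.
Proof. by split=> h x; have := h x; rewrite !normE -rmorphM/= lecR. Qed.

Lemma bop_bounded X : exists2 c, 0 <= c & bop_bound X c.
Proof.
have [_ [M hM]] := asboolW (valP X); exists `|M| => // x.
have := hM x; rewrite !normE -rmorphM/= lecR => /le_trans -> //.
by rewrite ler_wpM2r ?nrm_ge0// ler_norm.
Qed.

Lemma bop_of (f : H -> H) : linear f ->
  (exists c, forall x, nrm (f x) <= c * nrm x) ->
  exists X : bop H, forall x, X x = f x.
Proof.
move=> lf [c fc]; have fb : f \in @bounded_linear R H.
  apply/asboolP; split=> //; exists c => x.
  by rewrite !normE -rmorphM lecR.
by exists (Bop fb).
Qed.

(** Adjoints are kept as a relation, stable under sums and products, because [adjoint] may take its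
    default value; [is_adj X X] is self-adjointness. *)
Definition is_adj X Y := forall x y, rip (X x) y = rip x (Y y).

Lemma is_adjE X Y : is_adj X Y <-> forall x y, inner (X x) y = inner x (Y y).
Proof.
split=> h x y; last by rewrite /rip h.
by rewrite !innerE_rip h -[in RHS]linearZ h.
Qed.

Lemma is_adj_sym X Y : is_adj X Y -> is_adj Y X.
Proof. by move=> h x y; rewrite ripC -h ripC. Qed.

Lemma is_adj_inj X Y Z : is_adj X Y -> is_adj X Z -> Y = Z.
Proof.
move=> XY XZ; apply: bopP => y; apply/eqP; rewrite -subr_eq0; apply/eqP.
by apply: ripxx_eq0; rewrite [LHS]ripBr -XY -XZ subrr.
Qed.

Lemma is_adj0 : is_adj 0 0. Proof. by move=> x y; rewrite rip0l rip0r. Qed.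
Lemma is_adj1 : is_adj 1 1. Proof. by []. Qed.
Lemma is_adjD X X' Y Y' : is_adj X X' -> is_adj Y Y' -> is_adj (X + Y) (X' + Y').
Proof. by move=> h h' x y; rewrite !bopE ripDl ripDr h h'. Qed.
Lemma is_adjB X X' Y Y' : is_adj X X' -> is_adj Y Y' -> is_adj (X - Y) (X' - Y').
Proof. by move=> h h' x y; rewrite !bopE ripBl ripBr h h'. Qed.
Lemma is_adjM X X' Y Y' : is_adj X X' -> is_adj Y Y' -> is_adj (X * Y) (Y' * X').
Proof. by move=> h h' x y; rewrite !bopE h h'. Qed.
Lemma is_adjZ c X X' : is_adj X X' -> is_adj (c%:C *: X) (c%:C *: X').
Proof. by move=> h x y; rewrite !bopE ripZl ripZr h. Qed.
Lemma is_adj_sum (I : Type) (r : seq I) (F G : I -> bop H) :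
  (forall i, is_adj (F i) (G i)) -> is_adj (\sum_(i <- r) F i) (\sum_(i <- r) G i).
Proof.
by move=> h; elim/big_rec2: _ => [|i u v _]; [exact: is_adj0|exact: is_adjD].
Qed.

Lemma adjoint_eq X Y : is_adj X Y -> adjoint X = Y.
Proof.
move=> XY; apply: xget_unique => /=; first by move/is_adjE: XY.
by move=> Z XZ; apply: (is_adj_inj (X := X)) => //; apply/is_adjE.
Qed.

(** The default value is harmless: a product with left factor [adjoint X] then vanishes, whatever
    stands to its right. *)
Lemma adjointP X : (is_adj X (adjoint X)) \/ adjoint X = 0.
Proof.
rewrite /adjoint; case: xgetP => [Y _ XY|_]; last by right.
by left; apply/is_adjE.
Qed.

(** Self-adjointness comes from complex polarization: [rip (X z) ('i *: z)] vanishes for all [z],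
    and is expanded at [z = x + 'i *: y]. *)
Lemma op_ge0P X : op_ge0 X <-> is_adj X X /\ forall x, 0 <= rip (X x) x.
Proof.
split=> [X0|[sX X0 x]]; last first.
  have /is_adjE sX' := sX.
  have : complex.Im (inner (X x) x) = 0.
    have := congr1 (@complex.Im R) (innerC (X x) x); rewrite -sX'.
    by case: (inner (X x) x) => u v /=; lra.
  by have := X0 x; rewrite /rip lecE/=; case: (inner _ _) => u v /= -> ->; rewrite eqxx.
have X0' x : 0 <= rip (X x) x by have := X0 x; rewrite /rip lecE => /andP[].
have X1 x : rip (X x) ('i *: x) = 0.
  by have := X0 x; rewrite ripi lecE => /andP[/eqP].
split=> // x y.
have ii z : 'i *: ('i *: z) = - z :> H.
  by rewrite scalerA -expr2 sqr_i scaleN1r.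
have ripii (u v : H) : rip ('i *: u) ('i *: v) = rip u v.
  rewrite /rip innerZl innerZr; case: (inner u v) => p q /=; lra.
have h1 := X1 (x + 'i *: y).
move: h1; rewrite !linearD /= !linearZ/= ii !ripDl !ripDr !ripNr !ripii.
have -> : rip ('i *: X y) y = - rip (X y) ('i *: y).
  by rewrite -ripii ii ripNl.
by rewrite !X1 (ripC x); lra.
Qed.

Definition opin m M X := is_adj X X /\
  forall x, m * rip x x <= rip (X x) x <= M * rip x x.

(** Positivity at [c%:C *: x - X x] is combined with the upper bound at [X x]. This later turns a
    norm bound of the inverse into a lower bound of the form. *)
Lemma psd_nrm_le X c x : opin 0 c X -> 0 <= c ->
  rip (X x) (X x) <= c * rip (X x) x.
Proof.
move=> [sX Xc] c0.
have pos z : 0 <= rip (X z) z by have /andP[+ _] := Xc z; rewrite mul0r.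
have [c_eq0|cn0] := eqVneq c 0.
  have [_ Xle] := andP (Xc (X x)).
  have := pos (x - X x); rewrite c_eq0 mul0r in Xle *.
  have := Xc x; rewrite c_eq0 !mul0r => /andP[_ h].
  rewrite linearB ripBl !ripBr (sX (X x) x).
  have := pos (X x); have := pos x; lra.
have cp : 0 < c by rewrite lt_neqAle eq_sym cn0.
have /andP[_ h2] := Xc (X x).
have := pos (c%:C *: x - X x).
rewrite linearB linearZ ripBl !ripBr !ripZl !ripZr (sX (X x) x) => h1.
rewrite -subr_ge0 -(pmulr_rge0 _ cp); lra.
Qed.

(** Polarization bounds [rip (X x) y] through the forms at [x + y] and [x - y]; then [y] is taken
    parallel to [X x], with the norm of [x]. *)
Lemma opin_bound X c : opin (- c) c X -> 0 <= c -> bop_bound X c.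
Proof.
move=> [sX Xc] c0 x.
have key y : rip (X x) y <= c * (rip x x + rip y y) / 2.
  have /andP[_ h1] := Xc (x + y); have /andP[h2 _] := Xc (x - y).
  move: h1 h2; rewrite linearD linearB !ripDl !ripDr !ripNl !ripNr.
  by rewrite (sX y x) (ripC y (X x)) (ripC y x); lra.
have [Xx0|Xxn0] := eqVneq (nrm (X x)) 0; first by rewrite Xx0 mulr_ge0 ?nrm_ge0.
have Xx0 : 0 < nrm (X x) by rewrite lt_neqAle eq_sym Xxn0 nrm_ge0.
have := key ((nrm x / nrm (X x))%:C *: X x).
rewrite ripZr ripZl ripZr -!nrm_sqr.
have -> : nrm x / nrm (X x) * nrm (X x) ^+ 2 = nrm x * nrm (X x).
  by field.
have -> : nrm x / nrm (X x) * (nrm x * nrm (X x)) = nrm x ^+ 2.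
  by field.
have [x0 _|xn0] := eqVneq (nrm x) 0.
  have -> : x = 0 by apply: ripxx_eq0; rewrite -nrm_sqr x0 expr0n.
  by rewrite linear0 nrm0 mulr0.
have x0 : 0 < nrm x by rewrite lt_neqAle eq_sym xn0 nrm_ge0.
move=> h; rewrite -(ler_pM2l x0); lra.
Qed.

End BopBasics.

(** * Norm limits, Neumann series and the order on inverses *)

Section Inverses.
Context {R : realType} {H : hilbertType R}.
Implicit Types (x y z : H) (a b c d e m M : R) (X Y Z A B : bop H).

Lemma bop_bound_le X c d : c <= d -> bop_bound X c -> bop_bound X d.
Proof. by move=> cd h x; rewrite (le_trans (h x))// ler_wpM2r ?nrm_ge0. Qed.

Lemma bop_bound0 c : 0 <= c -> bop_bound (0 : bop H) c.
Proof. by move=> c0 x; rewrite bop0E nrm0 mulr_ge0 ?nrm_ge0. Qed.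

Lemma bop_bound1 : bop_bound (1 : bop H) 1.
Proof. by move=> x; rewrite mul1r. Qed.

Lemma bop_boundD X Y c d :
  bop_bound X c -> bop_bound Y d -> bop_bound (X + Y) (c + d).
Proof.
by move=> h k x; rewrite mulrDl (le_trans (ler_nrmD _ _))// lerD//; [exact: h|exact: k].
Qed.

Lemma bop_boundN X c : bop_bound X c -> bop_bound (- X) c.
Proof. by move=> h x; rewrite bopNE nrmN; exact: h. Qed.

Lemma bop_boundM X Y c d : 0 <= c ->
  bop_bound X c -> bop_bound Y d -> bop_bound (X * Y) (c * d).
Proof.
move=> c0 h k x; rewrite bopME (le_trans (h _))// -mulrA.
by rewrite ler_wpM2l//; exact: k.
Qed.

Lemma bop_bound_small X : (forall e, 0 < e -> bop_bound X e) -> X = 0.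
Proof.
move=> h; apply: bopP => x; apply: ripxx_eq0; rewrite -nrm_sqr.
apply/eqP; rewrite sqrf_eq0; apply/eqP/le_anti; rewrite nrm_ge0 andbT.
apply/ler_addgt0Pr => e e0; rewrite add0r.
have n0 : 0 < nrm x + 1 by rewrite ltr_wpDl ?nrm_ge0.
have := h (e / (nrm x + 1)) (divr_gt0 e0 n0) x.
move=> /le_trans; apply; rewrite mulrAC ler_pdivrMr// ler_wpM2l ?ltW//.
by rewrite ltrDl.
Qed.

Definition opcv (u : nat -> bop H) Y := forall e, 0 < e ->
  exists N, forall n, (N <= n)%N -> bop_bound (u n - Y) e.

Lemma op_cvgP u Y : op_cvg u Y <-> opcv u Y.
Proof.
split=> h e e0; have := h e e0.
  move=> [N _ hN]; exists N => n Nn; apply/bop_boundP => x; exact: hN.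
by move=> [N hN]; exists N => // n Nn; apply/bop_boundP; exact: hN.
Qed.

Lemma opcv_cst Y : opcv (fun=> Y) Y.
Proof. by move=> e e0; exists 0%N => n _; rewrite subrr; exact/bop_bound0/ltW. Qed.

Lemma opcvD u v Y Z : opcv u Y -> opcv v Z -> opcv (fun n => u n + v n) (Y + Z).
Proof.
move=> uY vZ e e0; have e20 : 0 < e / 2 by rewrite divr_gt0.
have [N1 h1] := uY _ e20; have [N2 h2] := vZ _ e20.
exists (maxn N1 N2) => n; rewrite geq_max => /andP[n1 n2].
rewrite opprD addrACA [e]splitr.
by apply: bop_boundD; [exact: h1|exact: h2].
Qed.

Lemma opcvN u Y : opcv u Y -> opcv (fun n => - u n) (- Y).
Proof.
move=> uY e e0; have [N hN] := uY _ e0; exists N => n Nn.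
by rewrite -opprD; apply/bop_boundN/hN.
Qed.

Lemma opcvM u v Y Z : opcv u Y -> opcv v Z -> opcv (fun n => u n * v n) (Y * Z).
Proof.
move=> uY vZ e e0.
have [y y0 hy] := bop_bounded Y; have [z z0 hz] := bop_bounded Z.
pose d := e / (y + z + 2).
have yz : 0 < y + z + 2 by lra.
have d0 : 0 < d by rewrite divr_gt0.
have [N1 h1] := uY _ d0; have [N2 h2] := vZ _ d0; have [N3 h3] := vZ _ ltr01.
exists (maxn N1 (maxn N2 N3)) => n; rewrite !geq_max => /and3P[n1 n2 n3].
have -> : u n * v n - Y * Z = (u n - Y) * ((v n - Z) + Z) + Y * (v n - Z).
  by rewrite subrK mulrBl mulrBr addrA subrK.
apply: (@bop_bound_le _ (d * (1 + z) + y * d)); last first.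
  apply: bop_boundD; apply: bop_boundM => //; [exact: ltW|exact: h1| |exact: h2].
  by apply: bop_boundD => //; exact: h3.
have : d * (y + z + 2) = e by rewrite /d; field; rewrite gt_eqF.
lra.
Qed.

Lemma opcv_bound u Y c : (exists N, forall n, (N <= n)%N -> bop_bound (u n) c) ->
  opcv u Y -> bop_bound Y c.
Proof.
move=> [N0 h0] uY x; apply/ler_addgt0Pr => e e0.
have n0 : 0 < nrm x + 1 by rewrite ltr_wpDl ?nrm_ge0.
have [N hN] := uY _ (divr_gt0 e0 n0).
pose n := maxn N0 N.
have := bop_boundD (h0 n (leq_maxl _ _)) (bop_boundN (hN n (leq_maxr _ _))).
rewrite opprB addrC subrK => /(_ x) /le_trans; apply.
rewrite mulrDl lerD2l mulrAC ler_pdivrMr// ler_wpM2l ?ltW//.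
by rewrite ltrDl.
Qed.

Lemma opcv_uniq u Y Z : opcv u Y -> opcv u Z -> Y = Z.
Proof.
move=> uY uZ; apply/eqP; rewrite -subr_eq0; apply/eqP/bop_bound_small => e e0.
apply: (opcv_bound (u := fun n => u n - u n)).
  by exists 0%N => n _; rewrite subrr; exact/bop_bound0/ltW.
by apply: opcvD => //; exact: opcvN.
Qed.

Lemma hilbert_complete (u : nat -> H) :
  (forall e, 0 < e -> exists N, forall p q, (N <= p)%N -> (N <= q)%N ->
     nrm (u p - u q) <= e) ->
  exists l, forall e, 0 < e -> exists N, forall n, (N <= n)%N ->
    nrm (u n - l) <= e.
Proof.
move=> uC.
have /cauchy_cvg uc : cauchy (u @ \oo).
  apply/cauchy_ballP => e e0.
  have eE : e = (complex.Re e)%:C by rewrite RRe_real// gtr0_real.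
  have e0' : 0 < complex.Re e / 2 by rewrite divr_gt0// -(ltcR 0) -eE.
  have [N hN] := uC _ e0'.
  exists (fun y => exists2 n, (N <= n)%N & y = u n,
          fun y => exists2 n, (N <= n)%N & y = u n).
    by split; exists N => // n Nn; exists n.
  move=> [y z] /= [[p Np ->] [q Nq ->]].
  rewrite -ball_normE/= normE eE ltcR (le_lt_trans (hN _ _ Np Nq))//.
  by move: e0'; lra.
exists (lim (u @ \oo)) => e e0.
have ec : 0 < e%:C by rewrite (ltcR 0).
have /cvgrPdist_le /(_ _ ec) [N _ hN] := uc.
exists N => n Nn; rewrite -lecR -normE distrC; exact: hN.
Qed.

Lemma bop_complete (u : nat -> bop H) :
  (forall e, 0 < e -> exists N, forall p q, (N <= p)%N -> (N <= q)%N ->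
     bop_bound (u p - u q) e) ->
  exists Y, opcv u Y.
Proof.
move=> uC.
have : forall x, exists l, forall e, 0 < e -> exists N, forall n, (N <= n)%N ->
    nrm (u n x - l) <= e.
  move=> x; apply: hilbert_complete => e e0.
  have n0 : 0 < nrm x + 1 by rewrite ltr_wpDl ?nrm_ge0.
  have [N hN] := uC _ (divr_gt0 e0 n0).
  exists N => p q Np Nq; have := hN p q Np Nq x.
  rewrite bopBE => /le_trans; apply.
  by rewrite mulrAC ler_pdivrMr// ler_wpM2l ?ltW// ltrDl.
move=> /choice[f hf].
have key e : 0 < e -> exists N, forall n, (N <= n)%N ->
    forall x, nrm (u n x - f x) <= e * nrm x.
  move=> e0; have [N hN] := uC _ e0; exists N => n Nn x.
  apply/ler_addgt0Pr => d d0; have [N' hN'] := hf x _ d0.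
  have := hN' (maxn N N') (leq_maxr _ _).
  have := hN _ _ Nn (leq_maxl N N') x; rewrite bopBE.
  have := ler_nrmD (u n x - u (maxn N N') x) (u (maxn N N') x - f x).
  by rewrite addrA subrK; lra.
have lf : linear f.
  move=> k x y; apply/eqP; rewrite -subr_eq0; apply/eqP; apply: ripxx_eq0.
  rewrite -nrm_sqr; apply/eqP; rewrite sqrf_eq0; apply/eqP/le_anti.
  rewrite nrm_ge0 andbT; apply/ler_addgt0Pr => e e0; rewrite add0r.
  pose s := nrm (k *: x + y) + Normc.normc k * nrm x + nrm y + 1.
  have k0 : 0 <= Normc.normc k by case: (k) => ? ?; exact: sqrtr_ge0.
  have s0 : 0 < s by rewrite /s ltr_wpDl// !addr_ge0 ?mulr_ge0 ?nrm_ge0.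
  have [N hN] := key _ (divr_gt0 e0 s0).
  have -> : f (k *: x + y) - (k *: f x + f y) =
      (f (k *: x + y) - u N (k *: x + y)) + (k *: (u N x - f x) + (u N y - f y)).
    rewrite [u N (k *: x + y)]linearP scalerBr [k *: _ - _ + _]addrACA.
    by rewrite -opprD addrA subrK.
  have h1 := hN N (leqnn _) (k *: x + y).
  have h2 := hN N (leqnn _) x; have h3 := hN N (leqnn _) y.
  rewrite -nrmN opprB in h1.
  have h4 := ler_nrmD (k *: (u N x - f x)) (u N y - f y).
  rewrite nrmZC in h4; have h5 := ler_wpM2l k0 h2.
  apply: (le_trans (ler_nrmD _ _)).
  apply: (@le_trans _ _ (e / s * (s - 1))); first by rewrite /s; lra.
  rewrite mulrAC ler_pdivrMr// ler_wpM2l ?ltW//; lra.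
have [N1 h1] := key _ ltr01.
have [c c0 hc] := bop_bounded (u N1).
have [|Y YE] := bop_of lf.
  exists (c + 1) => x; have := h1 _ (leqnn _) x; have := hc x.
  have := ler_nrmD (u N1 x) (- (u N1 x - f x)).
  by rewrite nrmN opprB addrC subrK mulrDl; lra.
exists Y => e e0; have [N hN] := key _ e0.
by exists N => n Nn x; rewrite bopBE YE; exact: hN.
Qed.

Lemma exprn_small (q e : R) : 0 <= q < 1 -> 0 < e ->
  exists N, forall n, (N <= n)%N -> q ^+ n <= e.
Proof.
move=> /andP[q0 q1] e0.
have /cvgrPdist_le /(_ _ e0) [N _ hN] : q ^+ n @[n --> \oo] --> (0 : R).
  by apply: cvg_expr; rewrite ger0_norm.
exists N => n Nn; have := hN n Nn; rewrite /= sub0r normrN ger0_norm//.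
exact: exprn_ge0.
Qed.

(** Neumann series: [K = 1 - X / M] has norm at most [1 - m / M < 1]. *)
Lemma opin_invertible m M X : 0 < m -> opin m M X -> invertible X.
Proof.
move=> m0 [sX hX].
(* [m <= M] can only fail on the zero space; enlarging [M] ensures [0 <= q]. *)
wlog mM : M hX / m <= M.
  move=> hw; apply: (hw (Num.max m M)); last by rewrite le_max lexx.
  move=> x; have /andP[-> h] := hX x; rewrite (le_trans h)// ler_wpM2r ?ripxx_ge0//.
  by rewrite le_max lexx orbT.
have M0 : 0 < M by exact: lt_le_trans mM.
pose q := 1 - m / M; pose K := 1 - (M^-1)%:C *: X.
have q01 : 0 <= q < 1.
  rewrite /q subr_ge0 ler_pdivrMr// mul1r mM/= ltrBlDr ltrDl divr_gt0//.
have /andP[q0 q1] := q01.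
have Kb : bop_bound K q.
  apply: opin_bound => //; split; first by exact: (is_adjB is_adj1 (is_adjZ _ sX)).
  move=> x; rewrite !bopE ripBl ripZl; have /andP[h1 h2] := hX x.
  have x0 := ripxx_ge0 x.
  have e1 : M^-1 * (m * rip x x) <= M^-1 * rip (X x) x.
    by rewrite ler_wpM2l// invr_ge0 ltW.
  have e2 : M^-1 * rip (X x) x <= rip x x.
    by rewrite mulrC ler_pdivrMr// mulrC.
  rewrite /q; apply/andP; split; last by rewrite mulrBl; lra.
  by have := mulr_ge0 q0 x0; rewrite /q; lra.
have Kn n : bop_bound (K ^+ n) (q ^+ n).
  elim: n => [|n IH]; first exact: bop_bound1.
  by rewrite !exprS; apply: bop_boundM.
pose S n := \sum_(i < n) K ^+ i.
have SB n p : bop_bound (S (n + p)%N - S n) (q ^+ n * (1 - q ^+ p) / (1 - q)).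
  elim: p => [|p IH].
    by rewrite addn0 !subrr mulr0 mul0r; apply: bop_bound0.
  rewrite addnS /S big_ord_recr/= addrAC.
  apply: bop_bound_le (bop_boundD IH (Kn _)).
  rewrite exprD exprS le_eqVlt; apply/orP; left; apply/eqP; field.
  by rewrite gt_eqF// subr_gt0.
have q1' : 0 < 1 - q by rewrite subr_gt0.
have SB' n p : (n <= p)%N -> bop_bound (S p - S n) (q ^+ n / (1 - q)).
  move=> /subnKC <-; apply: bop_bound_le (SB _ _).
  rewrite ler_pM2r ?invr_gt0// ler_piMr ?exprn_ge0//.
  by rewrite lerBlDr lerDl exprn_ge0.
have [|Y SY] := bop_complete (u := S).
  move=> e e0; have [N hN] := exprn_small q01 (mulr_gt0 e0 q1').
  have small n : (N <= n)%N -> q ^+ n / (1 - q) <= e.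
    by move=> /hN; rewrite ler_pdivrMr.
  exists N => a b Na Nb; have [ab|/ltnW ba] := leqP a b.
    rewrite -opprB; apply/bop_boundN.
    by apply: bop_bound_le (SB' _ _ ab); exact: small.
  by apply: bop_bound_le (SB' _ _ ba); exact: small.
have Kcv : opcv (fun n => 1 - K ^+ n) 1.
  move=> e e0; have [N hN] := exprn_small q01 e0.
  exists N => n /hN Nn; rewrite addrAC subrr sub0r; apply/bop_boundN.
  exact: bop_bound_le (Kn n).
have X1 : X = M%:C *: (1 - K).
  by rewrite /K opprB addrC subrK scalerA -rmorphM divff ?gt_eqF// scale1r.
have TS n : (1 - K) * S n = 1 - K ^+ n.
  elim: n => [|n IH]; first by rewrite /S big_ord0 mulr0 expr0 subrr.
  by rewrite /S big_ord_recr/= mulrDr IH mulrBl mul1r exprS addrA subrK.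
have ST n : S n * (1 - K) = 1 - K ^+ n.
  elim: n => [|n IH]; first by rewrite /S big_ord0 mul0r expr0 subrr.
  by rewrite /S big_ord_recr/= mulrDl IH mulrBr mulr1 exprSr addrA subrK.
have KY : (1 - K) * Y = 1.
  apply: opcv_uniq Kcv; under eq_fun do rewrite -TS.
  by apply: opcvM => //; exact: opcv_cst.
have YK : Y * (1 - K) = 1.
  apply: opcv_uniq Kcv; under eq_fun do rewrite -ST.
  by apply: opcvM => //; exact: opcv_cst.
exists ((M^-1)%:C *: Y); rewrite X1 !scale_bopAl !scale_bopAr KY YK !scalerA.
by rewrite -!rmorphM mulfV ?mulVf ?gt_eqF// scale1r.
Qed.

Lemma opinv_eq X Y : X * Y = 1 -> Y * X = 1 -> opinv X = Y.
Proof.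
move=> XY YX; apply: xget_unique => //= Z [XZ ZX].
by rewrite -[Y]mulr1 -XZ mulrA YX mul1r.
Qed.

Lemma opinvP X : invertible X -> X * opinv X = 1 /\ opinv X * X = 1.
Proof. by move=> [Y XY]; rewrite (opinv_eq XY.1 XY.2). Qed.

Lemma opinvK X : invertible X -> opinv (opinv X) = X.
Proof. by move=> /opinvP[h k]; exact: opinv_eq. Qed.

Lemma invertible_opinv X : invertible X -> invertible (opinv X).
Proof. by move=> /opinvP[h k]; exists X. Qed.

Lemma rip_le_bound X c x : bop_bound X c -> rip (X x) x <= c * rip x x.
Proof.
move=> Xc; rewrite -nrm_sqr expr2 mulrA.
by rewrite (le_trans (rip_le_nrm _ _))// ler_wpM2r ?nrm_ge0//; exact: Xc.
Qed.

(** If [c] bounds [X] and [k] its inverse, then [rip x x <= k ^+ 2 * rip (X x) (X x) <= k ^+ 2 * c *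
    rip (X x) x], whence a positive lower bound. *)
Lemma op_gt0P X : op_gt0 X <->
  exists m M, [/\ 0 < m, m <= M & opin m M X].
Proof.
split=> [[/op_ge0P[sX X0] /opinvP[XY YX]]|[m [M [m0 mM XmM]]]]; last first.
  split; last exact: opin_invertible XmM.
  case: XmM => sX hX; apply/op_ge0P; split=> // x.
  by have /andP[+ _] := hX x; apply/le_trans/mulr_ge0; rewrite ?ripxx_ge0 ?ltW.
have [c c0 hc] := bop_bounded X; have [k k0 hk] := bop_bounded (opinv X).
have Xc : opin 0 c X.
  by split=> // x; rewrite mul0r X0 rip_le_bound.
(* On the zero space [k] and [c] may be 0, hence the added 1. *)
set d := k ^+ 2 * c + 1.
have kc0 : 0 <= k ^+ 2 * c by rewrite mulr_ge0// sqr_ge0.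
have d0 : 0 < d by rewrite /d ltr_wpDl.
exists d^-1, (c + d^-1); split; rewrite ?invr_gt0 ?lerDr//.
split=> // x; apply/andP; split; last first.
  rewrite (le_trans (rip_le_bound x hc))// ler_wpM2r ?ripxx_ge0//.
  by rewrite lerDl invr_ge0 ltW.
rewrite mulrC ler_pdivrMr//.
have h1 : nrm x <= k * nrm (X x) by rewrite -{1}[x]bop1E -YX; exact: hk.
have h2 : rip x x <= k ^+ 2 * rip (X x) (X x).
  by rewrite -!nrm_sqr -exprMn lerXn2r ?nnegrE ?mulr_ge0 ?nrm_ge0.
have h3 := ler_wpM2l (sqr_ge0 k) (psd_nrm_le x Xc c0).
by have := X0 x; rewrite /d; lra.
Qed.

Lemma op_gt0_is_adj X : op_gt0 X -> is_adj X X.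
Proof. by case=> /op_ge0P[]. Qed.

Lemma op_gt0_rip X x : op_gt0 X -> 0 <= rip (X x) x.
Proof. by case=> /op_ge0P[_]. Qed.

Lemma op_gt0_opinv X : op_gt0 X -> op_gt0 (opinv X).
Proof.
move=> [/op_ge0P[sX X0] iX]; have [XY YX] := opinvP iX.
have YE x : X (opinv X x) = x by rewrite -bopME XY.
split; last exact: invertible_opinv.
apply/op_ge0P; split=> [x y|x]; first by rewrite -{1}[y]YE -sX YE.
by rewrite -{2}[x]YE ripC; exact: X0.
Qed.

Lemma op_leP X Y : is_adj X X -> is_adj Y Y ->
  op_le X Y <-> forall x, rip (X x) x <= rip (Y x) x.
Proof.
move=> sX sY; split=> [/op_ge0P[_ h] x|h].
  by have := h x; rewrite bopBE ripBl subr_ge0.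
apply/op_ge0P; split=> [|x]; first exact: is_adjB.
by rewrite bopBE ripBl subr_ge0.
Qed.

(** With [y = B^-1 x] and [z = A^-1 x], expand the form of [A] at [y - z], which is nonnegative, and
    use [rip (A y) y <= rip (B y) y = rip x y]. *)
Lemma opinv_antitone A B : op_gt0 A -> op_gt0 B ->
  (forall x, rip (A x) x <= rip (B x) x) ->
  forall x, rip (opinv B x) x <= rip (opinv A x) x.
Proof.
move=> A0 B0 AB x.
have [AZ _] := opinvP A0.2; have [BY _] := opinvP B0.2.
set z := opinv A x; set y := opinv B x.
have Az : A z = x by rewrite /z -bopME AZ.
have By : B y = x by rewrite /y -bopME BY.
have yAz : rip (A y) z = rip x y by rewrite op_gt0_is_adj// Az ripC.
have := op_gt0_rip (y - z) A0; rewrite bop_linB ripBl !ripBr Az yAz.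
have := AB y; rewrite By (ripC y x) (ripC z x); lra.
Qed.

End Inverses.

(** * Continuous functional calculus *)

Section PolynomialCalculus.
Context {R : realType} {H : hilbertType R}.
Implicit Types (x y z : H) (a b c d e m M : R) (X Y Z A B T : bop H).
Implicit Types (k : R[i]) (p q : {poly R}) (P Q : {poly R[i]}).

(** Complex coefficients allow a splitting into linear factors. *)
Definition cpoly_op P X : bop H := \sum_(i < size P) P`_i *: X ^+ i.

Lemma cpoly_op_wide n P X : (size P <= n)%N ->
  cpoly_op P X = \sum_(i < n) P`_i *: X ^+ i.
Proof.
move=> Pn; rewrite /cpoly_op (big_ord_widen n (fun i => P`_i *: X ^+ i))//.
rewrite [RHS](bigID (fun i : 'I_n => (i < size P)%N))/= [X in _ + X]big1 ?addr0//.
by move=> i; rewrite -leqNgt => /(nth_default 0) ->; rewrite scale0r.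
Qed.

Lemma cpoly_opD P Q X : cpoly_op (P + Q) X = cpoly_op P X + cpoly_op Q X.
Proof.
pose n := maxn (size P) (size Q).
rewrite !(@cpoly_op_wide n) ?leq_maxl ?leq_maxr ?size_polyD// -big_split/=.
by apply: eq_bigr => i _; rewrite coefD scalerDl.
Qed.

Lemma cpoly_opZ k P X : cpoly_op (k *: P) X = k *: cpoly_op P X.
Proof.
rewrite !(@cpoly_op_wide (size P)) ?size_scale_leq// scaler_sumr.
by apply: eq_bigr => i _; rewrite coefZ scalerA.
Qed.

Lemma cpoly_opC k X : cpoly_op k%:P X = k *: (1 : bop H).
Proof.
rewrite (@cpoly_op_wide 1) ?size_polyC ?leq_b1// big_ord1.
by rewrite coefC eqxx expr0.
Qed.

Lemma cpoly_opMX P X : cpoly_op (P * 'X) X = cpoly_op P X * X.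
Proof.
rewrite (@cpoly_op_wide (size P).+1); last first.
  by rewrite (leq_trans (size_polyMleq _ _))// size_polyX addn2.
rewrite big_ord_recl coefMX eqxx scale0r add0r /cpoly_op mulr_suml.
apply: eq_bigr => i _; rewrite coefMX /= exprSr.
by rewrite scale_bopAl.
Qed.

Lemma cpoly_opX X : cpoly_op 'X X = X.
Proof. by rewrite -['X]mul1r cpoly_opMX cpoly_opC scale1r mul1r. Qed.

Lemma cpoly_opXB k X : cpoly_op ('X - k%:P) X = X - k *: (1 : bop H).
Proof. by rewrite cpoly_opD cpoly_opX -polyCN cpoly_opC scaleNr. Qed.

Lemma cpoly_opM P Q X : cpoly_op (P * Q) X = cpoly_op P X * cpoly_op Q X.
Proof.
elim/poly_ind: Q => [|Q c IH].
  by rewrite mulr0 -polyC0 cpoly_opC scale0r mulr0.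
rewrite mulrDr mulrA !cpoly_opD !cpoly_opMX IH mulrDr mulrA.
by rewrite mulrC mul_polyC cpoly_opZ cpoly_opC scale_bopAr mulr1.
Qed.

Lemma poly_opE p X : poly_op p X = cpoly_op (map_poly (real_complex R) p) X.
Proof.
rewrite /poly_op /cpoly_op size_map_poly; apply: eq_bigr => i _.
by rewrite coef_map.
Qed.

Lemma poly_opD p q X : poly_op (p + q) X = poly_op p X + poly_op q X.
Proof. by rewrite !poly_opE rmorphD cpoly_opD. Qed.
Lemma poly_opZ c p X : poly_op (c *: p) X = c%:C *: poly_op p X.
Proof. by rewrite !poly_opE map_polyZ cpoly_opZ. Qed.
Lemma poly_opN p X : poly_op (- p) X = - poly_op p X.
Proof. by rewrite -scaleN1r poly_opZ rmorphN1 scaleN1r. Qed.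
Lemma poly_opB p q X : poly_op (p - q) X = poly_op p X - poly_op q X.
Proof. by rewrite poly_opD poly_opN. Qed.
Lemma poly_opM p q X : poly_op (p * q) X = poly_op p X * poly_op q X.
Proof. by rewrite !poly_opE rmorphM cpoly_opM. Qed.
Lemma poly_opC c X : poly_op c%:P X = c%:C *: (1 : bop H).
Proof. by rewrite poly_opE map_polyC cpoly_opC. Qed.
Lemma poly_opX X : poly_op 'X X = X.
Proof. by rewrite poly_opE map_polyX cpoly_opX. Qed.

Lemma poly_op_is_adj p X : is_adj X X -> is_adj (poly_op p X) (poly_op p X).
Proof.
move=> sX; elim/poly_ind: p => [|p c IH].
  by rewrite -polyC0 poly_opC scale0r; exact: is_adj0.
rewrite poly_opD poly_opC; apply: is_adjD; last exact: is_adjZ is_adj1.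
rewrite {2}mulrC !poly_opM poly_opX; exact: is_adjM.
Qed.

Lemma poly_op_eigen p X x t : X x = t%:C *: x ->
  poly_op p X x = (p.[t])%:C *: x.
Proof.
move=> Xx; elim/poly_ind: p => [|p c IH].
  by rewrite -polyC0 poly_opC hornerC scale0r bop0E scale0r.
rewrite poly_opD poly_opM poly_opX poly_opC bopDE bopME bopZE bop1E Xx bop_linZ IH.
by rewrite scalerA -scalerDl -rmorphM -rmorphD !hornerE mulrC.
Qed.

Lemma poly_op_scale p X c : poly_op p (c%:C *: X) = poly_op (p \Po (c *: 'X)) X.
Proof.
elim/poly_ind: p => [|p d IH].
  by rewrite comp_poly0 -!polyC0 !poly_opC.
rewrite comp_polyD comp_polyM comp_polyX comp_polyC !poly_opD !poly_opM IH.
by rewrite poly_opZ !poly_opX !poly_opC.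
Qed.

Lemma invertible_comm_factor A B : A * B = B * A -> invertible (A * B) ->
  invertible A.
Proof.
move=> AB [W [h1 h2]]; exists (B * W); split; first by rewrite mulrA.
have BC : B * (A * B) = A * B * B by rewrite mulrA -AB.
have -> : B * W = W * B.
  rewrite -[RHS]mulr1 -h1 -[RHS]mulrA [B * (_ * _)]mulrA BC.
  by rewrite -[A * B * B * W]mulrA [RHS]mulrA h2 mul1r.
by rewrite -mulrA -AB h2.
Qed.

Lemma invertibleM A B : invertible A -> invertible B -> invertible (A * B).
Proof.
move=> [A' [h1 h2]] [B' [h3 h4]]; exists (B' * A'); split.
  by rewrite mulrA -(mulrA A) h3 mulr1.
by rewrite mulrA -(mulrA B') h2 mulr1.
Qed.

Lemma invertibleZ k A : k != 0 -> invertible A -> invertible (k *: A).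
Proof.
move=> k0 [B [h1 h2]]; exists (k^-1 *: B).
by rewrite !scale_bopAl !scale_bopAr h1 h2 !scalerA mulfV ?mulVf// scale1r.
Qed.

(** For [k = u + i v], the product with the commuting factor of the conjugate of [k] is
    [(X - u)^2 + v^2], which is at least [v^2 > 0]. *)
Lemma nonreal_resolvent X k : is_adj X X -> complex.Im k != 0 ->
  invertible (X - k *: (1 : bop H)).
Proof.
move=> sX; case: k => u v /= v0.
rewrite -cpoly_opXB.
apply: (@invertible_comm_factor _ (cpoly_op ('X - (u -i* v)%:P) X)).
  by rewrite -!cpoly_opM mulrC.
rewrite -cpoly_opM.
have -> : ('X - (u +i* v)%:P) * ('X - (u -i* v)%:P) =
    map_poly (real_complex R) (('X - u%:P) * ('X - u%:P) + (v ^+ 2)%:P).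
  rewrite rmorphD rmorphM rmorphB/= map_polyX !map_polyC/=.
  pose w : R[i] := v *i.
  have -> : u +i* v = u%:C + w by rewrite /w; simpc.
  have -> : u -i* v = u%:C - w by rewrite /w; simpc.
  have -> : (v ^+ 2)%:C = - (w * w) by rewrite /w; simpc; rewrite expr2.
  by rewrite polyCB polyCD polyCN polyCM; ring.
rewrite -poly_opE poly_opD poly_opM poly_opB poly_opX !poly_opC.
set Y := X - _.
have sY : is_adj Y Y by apply: is_adjB => //; exact: is_adjZ is_adj1.
have [B B0 hB] := bop_bounded (Y * Y + (v ^+ 2)%:C *: (1 : bop H)).
apply: (@opin_invertible _ _ (v ^+ 2) B); first by rewrite exprn_even_gt0.
split; first by apply: is_adjD; [exact: is_adjM|exact: is_adjZ is_adj1].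
move=> x; rewrite rip_le_bound// andbT !bopE ripDl ripZl sY lerDr.
exact: ripxx_ge0.
Qed.


(** Over the complex numbers [p] splits: nonreal roots fall under [nonreal_resolvent], and real
    roots lie outside the spectrum. *)
Lemma poly_op_invertible p X : is_adj X X -> p != 0 ->
  (forall t, spectrum X t%:C -> p.[t] != 0) -> invertible (poly_op p X).
Proof.
move=> sX p0 hp; rewrite poly_opE.
have [r rE] := closed_field_poly_normal (map_poly (real_complex R) p).
have rP k : k \in r -> invertible (X - k *: (1 : bop H)).
  move=> kr; have : root (map_poly (real_complex R) p) k.
    rewrite rE rootE hornerZ horner_prod (big_rem k)//= hornerXsubC subrr.
    by rewrite mul0r mulr0.
  have [k0|/(nonreal_resolvent sX)//] := eqVneq (complex.Im k) 0.
  have -> : k = (complex.Re k)%:C by case: (k) k0 => u v /= ->.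
  rewrite rootE horner_map fmorph_eq0 => pk.
  by apply: contrapT => /hp; rewrite (eqP pk) eqxx.
rewrite rE cpoly_opZ; apply: invertibleZ.
  by rewrite lead_coef_eq0 map_poly_eq0.
elim: r rP {rE} => [|k r IH] rP.
  by rewrite big_nil -polyC1 cpoly_opC scale1r; exists 1; rewrite mulr1.
rewrite big_cons cpoly_opM; apply: invertibleM.
  by rewrite cpoly_opXB; apply: rP; rewrite mem_head.
by apply: IH => l lr; apply: rP; rewrite inE lr orbT.
Qed.

(** [l] is the supremum of the lower bounds of the form, which [x0] bounds from above. Were [T - l]
    invertible, it would be strictly positive and [l] could be increased. *)
Lemma lower_bound_spectrum T x0 : is_adj T T -> 0 < rip x0 x0 ->
  exists l, [/\ l * rip x0 x0 <= rip (T x0) x0,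
    (forall x, l * rip x x <= rip (T x) x) & ~ invertible (T - l%:C *: (1 : bop H))].
Proof.
move=> sT x0p; pose S := [set s | forall x, s * rip x x <= rip (T x) x].
have [c c0 hc] := bop_bounded (- T).
have Sc : S (- c).
  move=> x; have := rip_le_bound x hc; rewrite bopNE ripNl; lra.
have Sub s : S s -> s <= rip (T x0) x0 / rip x0 x0.
  by move=> /(_ x0); rewrite ler_pdivlMr.
have hS : has_sup S.
  split; first by exists (- c).
  by exists (rip (T x0) x0 / rip x0 x0) => s /Sub.
have Sl : S (sup S).
  move=> x; have := ripxx_ge0 x; rewrite le_eqVlt => /predU1P[x_eq0|xp].
    by rewrite (ripxx_eq0 (esym x_eq0)) bop_lin0 !rip0l mulr0.
  rewrite -ler_pdivlMr//; apply: ge_sup => [|s Ss]; first exact: hS.1.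
  by rewrite ler_pdivlMr//; exact: Ss.
exists (sup S); split=> // iT.
have : op_gt0 (T - (sup S)%:C *: (1 : bop H)).
  split=> //; apply/op_ge0P; split.
    by apply: is_adjB => //; exact: is_adjZ is_adj1.
  by move=> x; rewrite !bopE ripBl ripZl subr_ge0; exact: Sl.
move=> /op_gt0P[m [M [m0 _ [_ h]]]].
have : S (sup S + m).
  move=> x; have /andP[+ _] := h x; rewrite !bopE ripBl ripZl; lra.
by move=> /(ub_le_sup hS.2); rewrite leNgt ltrDl m0.
Qed.

(** A negative value of the form would put some [l < 0] in the spectrum of [p(X)], whereas [p - l]
    is positive on that of [X], so that [p(X) - l] is invertible. *)
Lemma poly_op_ge0 p X : is_adj X X ->
  (forall t, spectrum X t%:C -> 0 <= p.[t]) ->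
  forall x, 0 <= rip (poly_op p X x) x.
Proof.
move=> sX hp x; rewrite leNgt; apply/negP => px.
have x0 : 0 < rip x x.
  rewrite lt_neqAle ripxx_ge0 andbT; apply/eqP => /esym/ripxx_eq0 xE.
  by move: px; rewrite xE rip0r ltxx.
have [l [lx _ nl]] := lower_bound_spectrum (poly_op_is_adj p sX) x0.
have l0 : l < 0 by rewrite -(pmulr_llt0 _ x0) (le_lt_trans lx).
(* When [p - l] is the zero polynomial, the contradiction comes from the spectrum of [X] being
   nonempty. *)
have [pE|pl] := eqVneq p l%:P.
  have [s [_ _ ns]] := lower_bound_spectrum sX x0.
  by have := hp _ ns; rewrite pE hornerC leNgt l0.
apply: nl; rewrite -(poly_opC _ X) -poly_opB; apply: poly_op_invertible => //.
  by rewrite subr_eq0.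
move=> t /hp pt; rewrite !hornerE subr_eq0 gt_eqF//; exact: lt_le_trans pt.
Qed.

Lemma poly_op_lb p X c : is_adj X X ->
  (forall t, spectrum X t%:C -> c <= p.[t]) ->
  forall x, c * rip x x <= rip (poly_op p X x) x.
Proof.
move=> sX hp x; have := @poly_op_ge0 (p - c%:P) X sX _ x.
rewrite poly_opB poly_opC !(bopBE, bopZE, bop1E) ripBl ripZl subr_ge0; apply.
by move=> t /hp; rewrite !hornerE subr_ge0.
Qed.

Lemma poly_op_bound p X c : is_adj X X -> 0 <= c ->
  (forall t, spectrum X t%:C -> `|p.[t]| <= c) -> bop_bound (poly_op p X) c.
Proof.
move=> sX c0 hp; apply: opin_bound => //; split; first exact: poly_op_is_adj.
move=> x; apply/andP; split.
  by apply: poly_op_lb => // t /hp; rewrite ler_norml => /andP[].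
have := @poly_op_lb (- p) X (- c) sX _ x.
rewrite poly_opN bopNE ripNl mulNr lerN2; apply => t /hp.
by rewrite hornerN lerN2 ler_norml => /andP[].
Qed.

Lemma spectrum_opin m M X t : opin m M X -> spectrum X t%:C -> m <= t <= M.
Proof.
move=> [sX hX] Xt; apply/negP => /negP; rewrite negb_and -!ltNge => tP.
apply: Xt; have s1 : is_adj (X - t%:C *: (1 : bop H)) (X - t%:C *: (1 : bop H)).
  by apply: is_adjB => //; exact: is_adjZ is_adj1.
case/orP: tP => tP.
  apply: (@opin_invertible _ _ (m - t) (M - t)); first by rewrite subr_gt0.
  split=> // x; have /andP[h1 h2] := hX x.
  by rewrite !bopE ripBl ripZl; apply/andP; split; lra.
suff : invertible (- (X - t%:C *: (1 : bop H))).
  rewrite -[- _]scaleN1r => /(invertibleZ (_ : (-1 : R[i]) != 0)).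
  by rewrite scalerA mulN1r opprK scale1r; apply; rewrite oppr_eq0 oner_eq0.
apply: (@opin_invertible _ _ (t - M) (t - m)); first by rewrite subr_gt0.
split=> [|x]; last first.
  have /andP[h1 h2] := hX x.
  by rewrite bopNE ripNl !bopE ripBl ripZl; apply/andP; split; lra.
by rewrite opprB; apply: is_adjB => //; exact: is_adjZ is_adj1.
Qed.

End PolynomialCalculus.

(* The definition of [cfc] is locked: otherwise unification unfolds it. *)
HB.lock Definition fcalc {R : realType} {H : hilbertType R} (f : R -> R)
  (X : bop H) : bop H := cfc f X.

(** * From polynomials to continuous functions *)

Section FunctionalCalculus.
Context {R : realType} {H : hilbertType R}.
Implicit Types (x y z : H) (a b c d e m M : R) (X Y Z A B T : bop H).
Implicit Types (p q : {poly R}) (f g : R -> R).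

Lemma fcalcE f X : fcalc f X = cfc f X.
Proof. by rewrite fcalc.unlock. Qed.

Lemma is_cfc_poly_bound f X Y q e : is_adj X X -> is_cfc f X Y -> 0 <= e ->
  (forall t, spectrum X t%:C -> `|q.[t] - f t| <= e) ->
  bop_bound (poly_op q X - Y) e.
Proof.
move=> sX [p [pf /op_cvgP pY]] e0 qf x; apply/ler_addgt0Pr => d d0.
have n0 : 0 < nrm x + 1 by rewrite ltr_wpDl ?nrm_ge0.
have d' : 0 < d / (nrm x + 1) / 2 by rewrite !divr_gt0.
have [N1 _ h1] := pf _ d'; have [N2 h2] := pY _ d'.
pose n := maxn N1 N2.
have := @poly_op_bound _ _ (q - p n) X (e + d / (nrm x + 1) / 2) sX.
rewrite addr_ge0 ?(ltW d')// => /(_ isT) h3.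
have {}h3 : bop_bound (poly_op (q - p n) X) (e + d / (nrm x + 1) / 2).
  apply: h3 => t Xt; rewrite !hornerE.
  have := qf t Xt; have := h1 n (leq_maxl _ _) t Xt; rewrite distrC.
  have := ler_distD (f t) q.[t] (p n).[t]; lra.
have := bop_boundD h3 (h2 n (leq_maxr _ _)).
rewrite poly_opB addrA subrK -addrA -splitr => /(_ x) /le_trans; apply.
rewrite mulrDl lerD2l mulrAC ler_pdivrMr// ler_wpM2l ?ltW//.
by rewrite ltrDl.
Qed.

Lemma is_cfc_uniq f X Y Z : is_adj X X -> is_cfc f X Y -> is_cfc f X Z -> Y = Z.
Proof.
move=> sX fY [p [pf /op_cvgP pZ]]; apply: opcv_uniq pZ => e e0.
have [N _ hN] := pf _ e0; exists N => n Nn.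
by apply: is_cfc_poly_bound fY _ _ => //; [exact: ltW|exact: hN].
Qed.

Lemma fcalc_eq f X Y : is_adj X X -> is_cfc f X Y -> fcalc f X = Y.
Proof.
by move=> sX fY; rewrite fcalcE; apply: xget_unique => // Z fZ; exact: is_cfc_uniq fZ fY.
Qed.

Lemma is_cfc_ext f g X Y : (forall t, spectrum X t%:C -> f t = g t) ->
  is_cfc f X Y -> is_cfc g X Y.
Proof.
move=> fg [p [pf pY]]; exists p; split=> // e /pf; apply: filterS => n + t Xt.
by move=> /(_ t Xt); rewrite fg.
Qed.

Lemma is_cfc_poly p X : is_cfc (horner p) X (poly_op p X).
Proof.
exists (fun=> p); split; last by apply/op_cvgP; exact: opcv_cst.
by move=> e e0; exists 0%N => // n _ t _; rewrite subrr normr0 ltW.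
Qed.

Lemma is_cfcM f g X Y Z c : is_adj X X ->
  (forall t, spectrum X t%:C -> `|f t| <= c) ->
  (forall t, spectrum X t%:C -> `|g t| <= c) ->
  is_cfc f X Y -> is_cfc g X Z -> is_cfc (fun t => f t * g t) X (Y * Z).
Proof.
move=> sX fc gc [p [pf /op_cvgP pY]] [q [qg /op_cvgP qZ]].
exists (fun n => p n * q n); split; last first.
  apply/op_cvgP; under eq_fun do rewrite poly_opM.
  exact: opcvM.
move=> e e0; have c0 : 0 < 2 * `|c| + 1 by rewrite ltr_wpDl.
(* The error is at most d^2 + 2|c|d, which [d <= 1] reduces to d(2|c| + 1). *)
pose d := Num.min 1 (e / (2 * `|c| + 1)).
have d0 : 0 < d by rewrite lt_min ltr01 divr_gt0.
near=> n.
have h1' : forall t, spectrum X t%:C -> `|(p n).[t] - f t| <= d.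
  by near: n; exact: pf.
have h2' : forall t, spectrum X t%:C -> `|(q n).[t] - g t| <= d.
  by near: n; exact: qg.
move=> t Xt; have h1 := h1' t Xt; have h2 := h2' t Xt.
rewrite hornerM.
have -> : (p n).[t] * (q n).[t] - f t * g t =
    ((p n).[t] - f t) * ((q n).[t] - g t) + ((p n).[t] - f t) * g t +
    f t * ((q n).[t] - g t) by ring.
have d1 : d <= 1 by rewrite ge_min lexx.
have de : d * (2 * `|c| + 1) <= e.
  by rewrite -ler_pdivlMr// ge_min lexx orbT.
have fc' := le_trans (fc t Xt) (ler_norm c).
have gc' := le_trans (gc t Xt) (ler_norm c).
rewrite (le_trans (ler_normD _ _))//.
apply: (le_trans (lerD (ler_normD _ _) (lexx _))); rewrite !normrM.
have d0' := ltW d0.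
have e1 := ler_pM (normr_ge0 _) (normr_ge0 _) h1 h2.
have e2 := ler_pM (normr_ge0 _) (normr_ge0 _) h1 gc'.
have e3 := ler_pM (normr_ge0 _) (normr_ge0 _) fc' h2.
have e4 : d * d <= d by rewrite ler_piMl.
lra.
Unshelve. all: by end_near.
Qed.

Definition pos_continuous f := {within `]0, +oo[, continuous f}.

Lemma pos_continuous_itv f m M : 0 < m -> pos_continuous f ->
  {within `[m, M], continuous f}.
Proof.
move=> m0; apply: continuous_subspaceW => x /=; rewrite !in_itv/= andbT.
by move=> /andP[+ _]; apply: lt_le_trans.
Qed.

Lemma pos_continuous_bounded f m M : 0 < m -> m <= M -> pos_continuous f ->
  exists2 c, 0 <= c & forall t, m <= t <= M -> `|f t| <= c.
Proof.
move=> m0 mM /(pos_continuous_itv (M := M) m0) fc.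
have [K K0 hK] := continuous_segment_quad mM fc ltr01.
exists (`|f m| + 1 + K * (M - m) ^+ 2).
  by rewrite !addr_ge0// mulr_ge0// sqr_ge0.
move=> t tmM; have mmM : m <= m <= M by rewrite lexx.
have := hK t m tmM mmM.
have : K * (t - m) ^+ 2 <= K * (M - m) ^+ 2.
  case/andP: tmM => tm tM.
  by rewrite ler_wpM2l// lerXn2r ?nnegrE ?subr_ge0// lerB.
have := ler_normD (f m) (f t - f m); rewrite addrC subrK; lra.
Qed.

Lemma fcalcP f X : op_gt0 X -> pos_continuous f -> is_cfc f X (fcalc f X).
Proof.
move=> X0 fc; rewrite fcalcE; apply: xgetPex.
have [m [M [m0 mM XmM]]] := (op_gt0P X).1 X0; have sX := XmM.1.
have fc' := pos_continuous_itv (M := M) m0 fc.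
have /choice[p hp] : forall n : nat, exists p : {poly R},
    forall t, m <= t <= M -> `|p.[t] - f t| <= n.+1%:R^-1.
  by move=> n; apply: (weierstrass mM fc'); rewrite invr_gt0 ltr0n.
have small e : 0 < e -> exists N, forall n, (N <= n)%N -> n.+1%:R^-1 <= e.
  move=> e0; exists (Num.truncn e^-1) => n Nn.
  rewrite invf_ple ?posrE ?ltr0n// ltW//.
  by rewrite (lt_le_trans (truncnS_gt _))// ler_nat.
have [|Y pY] := bop_complete (u := fun n => poly_op (p n) X).
  move=> e e0; have e20 : 0 < e / 2 by rewrite divr_gt0.
  have [N hN] := small _ e20; exists N => a b Na Nb; rewrite -poly_opB.
  apply: poly_op_bound => //; first exact: ltW.
  move=> t /(spectrum_opin XmM) tmM; rewrite !hornerE.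
  have := le_trans (hp a t tmM) (hN _ Na).
  have := le_trans (hp b t tmM) (hN _ Nb).
  have := ler_distD (f t) (p a).[t] (p b).[t]; rewrite (distrC (f t)); lra.
exists Y; exists p; split; last by apply/op_cvgP.
move=> e e0; have [N hN] := small _ e0; exists N => // n Nn t.
by move=> /(spectrum_opin XmM)/hp/le_trans; apply; exact: hN.
Qed.

Section OpGt0.
Variables (f : R -> R) (X : bop H) (m M : R).
Hypotheses (fc : pos_continuous f) (m0 : 0 < m) (mM : m <= M).
Hypothesis XmM : opin m M X.

Let X0 : op_gt0 X. Proof. by apply/op_gt0P; exists m, M. Qed.
Let sX : is_adj X X. Proof. exact: XmM.1. Qed.

Lemma fcalc_approx q e : 0 <= e ->
  (forall t, m <= t <= M -> `|q.[t] - f t| <= e) ->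
  bop_bound (poly_op q X - fcalc f X) e.
Proof.
move=> e0 qf; apply: (is_cfc_poly_bound (f := f)) => //; first exact: fcalcP.
by move=> t /(spectrum_opin XmM)/qf.
Qed.

Lemma fcalc_approx_ex e : 0 < e -> exists2 q,
  forall t, m <= t <= M -> `|q.[t] - f t| <= e &
  bop_bound (poly_op q X - fcalc f X) e.
Proof.
move=> e0; have [q qf] := weierstrass mM (pos_continuous_itv m0 fc) e0.
by exists q => //; apply: fcalc_approx => //; exact: ltW.
Qed.

Lemma fcalc_is_adj : is_adj (fcalc f X) (fcalc f X).
Proof.
move=> x y; apply/eqP; rewrite -subr_eq0 -normr_le0; apply/ler_addgt0Pr => e e0.
rewrite add0r; pose s := 2 * nrm x * nrm y + 1.
have s0 : 0 < s by rewrite /s ltr_wpDl// !mulr_ge0 ?nrm_ge0.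
have [q _ hq] := fcalc_approx_ex (divr_gt0 e0 s0).
set P := poly_op q X in hq; have sP : is_adj P P by exact: poly_op_is_adj.
have -> : rip (fcalc f X x) y - rip x (fcalc f X y) =
    rip x ((P - fcalc f X) y) - rip ((P - fcalc f X) x) y.
  by rewrite !bopBE ripBl ripBr sP; lra.
have h1 := rip_le_nrm x ((P - fcalc f X) y).
have h2 := rip_le_nrm x (- (P - fcalc f X) y).
have h3 := rip_le_nrm ((P - fcalc f X) x) y.
have h4 := rip_le_nrm (- (P - fcalc f X) x) y.
rewrite ripNr nrmN in h2; rewrite ripNl nrmN in h4.
have h5 := ler_wpM2l (nrm_ge0 x) (hq y); have h6 := ler_wpM2r (nrm_ge0 y) (hq x).
have : e / s * (2 * nrm x * nrm y) <= e.
  by rewrite mulrAC ler_pdivrMr// ler_wpM2l ?ltW// /s ltrDl.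
by rewrite ler_norml => ?; apply/andP; split; lra.
Qed.

Lemma fcalc_lb c : (forall t, m <= t <= M -> c <= f t) ->
  forall x, c * rip x x <= rip (fcalc f X x) x.
Proof.
move=> cf x; apply/ler_addgt0Pr => e e0; pose s := 2 * rip x x + 1.
have x0 := ripxx_ge0 x.
have s0 : 0 < s by rewrite /s ltr_wpDl// mulr_ge0.
have [q qf hq] := fcalc_approx_ex (divr_gt0 e0 s0).
have h1 := rip_le_bound x hq; rewrite bopBE ripBl in h1.
have h2 : (c - e / s) * rip x x <= rip (poly_op q X x) x.
  apply: poly_op_lb => // t /(spectrum_opin XmM) tmM.
  by have := cf t tmM; have := qf t tmM; rewrite ler_norml => /andP[]; lra.
have : e / s * (2 * rip x x) <= e.
  by rewrite mulrAC ler_pdivrMr// ler_wpM2l ?ltW// /s ltrDl.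
lra.
Qed.

Lemma fcalc_ub c : (forall t, m <= t <= M -> f t <= c) ->
  forall x, rip (fcalc f X x) x <= c * rip x x.
Proof.
move=> cf x; apply/ler_addgt0Pr => e e0; pose s := 2 * rip x x + 1.
have x0 := ripxx_ge0 x.
have s0 : 0 < s by rewrite /s ltr_wpDl// mulr_ge0.
have [q qf hq] := fcalc_approx_ex (divr_gt0 e0 s0).
have h1 := rip_le_bound x (bop_boundN hq); rewrite bopNE bopBE ripNl ripBl in h1.
have h2 : (- c - e / s) * rip x x <= rip (poly_op (- q) X x) x.
  apply: poly_op_lb => // t /(spectrum_opin XmM) tmM; rewrite hornerN.
  by have := cf t tmM; have := qf t tmM; rewrite ler_norml => /andP[]; lra.
rewrite poly_opN bopNE ripNl in h2.
have : e / s * (2 * rip x x) <= e.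
  by rewrite mulrAC ler_pdivrMr// ler_wpM2l ?ltW// /s ltrDl.
lra.
Qed.

Lemma fcalc_eigen t x : m <= t <= M -> X x = t%:C *: x ->
  fcalc f X x = (f t)%:C *: x.
Proof.
move=> tmM Xx; apply/eqP; rewrite -subr_eq0; apply/eqP; apply: ripxx_eq0.
rewrite -nrm_sqr; apply/eqP; rewrite sqrf_eq0; apply/eqP/le_anti.
rewrite nrm_ge0 andbT; apply/ler_addgt0Pr => e e0; rewrite add0r.
pose s := 2 * nrm x + 1; have x0 := nrm_ge0 x.
have s0 : 0 < s by rewrite /s ltr_wpDl// mulr_ge0.
have [q qf hq] := fcalc_approx_ex (divr_gt0 e0 s0).
have := hq x; rewrite bopBE (poly_op_eigen _ Xx) -nrmN opprB => h1.
have h2 := ler_wpM2r x0 (qf t tmM); rewrite -nrmZ in h2.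
have := ler_nrmD (fcalc f X x - q.[t]%:C *: x) ((q.[t] - f t)%:C *: x).
rewrite rmorphB scalerBl addrA subrK => h3.
have : e / s * (2 * nrm x) <= e.
  by rewrite mulrAC ler_pdivrMr// ler_wpM2l ?ltW// /s ltrDl.
rewrite rmorphB scalerBl in h2; lra.
Qed.

End OpGt0.

Lemma fcalc_op_gt0 f X : pos_continuous f -> (forall t, 0 < t -> 0 < f t) ->
  op_gt0 X -> op_gt0 (fcalc f X).
Proof.
move=> fc f0 /op_gt0P[m [M [m0 mM XmM]]].
have [c cm hc] := EVT_min mM (pos_continuous_itv m0 fc).
have [K K0 hK] := pos_continuous_bounded m0 mM fc.
have fc0 : 0 < f c.
  by move: cm; rewrite in_itv/= => /andP[mc _]; apply: f0; exact: lt_le_trans mc.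
apply/op_gt0P; exists (f c), (f c + K); split; rewrite ?lerDl//.
split; first exact: fcalc_is_adj XmM.
move=> x; rewrite (fcalc_lb fc m0 mM XmM)=> [|t tmM]; last by apply: hc; rewrite in_itv.
rewrite (fcalc_ub fc m0 mM XmM)// => t tmM.
by rewrite (le_trans (ler_norm _))// (le_trans (hK t tmM))// lerDr ltW.
Qed.

Lemma fcalcM f g X : pos_continuous f -> pos_continuous g -> op_gt0 X ->
  pos_continuous (fun t => f t * g t) ->
  fcalc (fun t => f t * g t) X = fcalc f X * fcalc g X.
Proof.
move=> fc gc X0; have sX := op_gt0_is_adj X0.
move=> fgc; have [m [M [m0 mM XmM]]] := (op_gt0P X).1 X0.
have [c c0 hc] := pos_continuous_bounded m0 mM fc.
have [d d0 hd] := pos_continuous_bounded m0 mM gc.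
apply: fcalc_eq => //; apply: (@is_cfcM _ _ _ _ _ (c + d)) => //.
- by move=> t /(spectrum_opin XmM)/hc/le_trans; apply; rewrite lerDl.
- by move=> t /(spectrum_opin XmM)/hd/le_trans; apply; rewrite lerDr.
- exact: fcalcP.
- exact: fcalcP.
Qed.

End FunctionalCalculus.

(** * Operator means *)

Lemma mulr_sandwich (A : pzRingType) (s t w v : A) :
  s * t = 1 -> w * v = 1 -> s * w * s * (t * v * t) = 1.
Proof.
by move=> st wv; rewrite -!mulrA (mulrA s t) st mul1r (mulrA w v) wv mul1r.
Qed.

Section OperatorMeans.
Context {R : realType} {H : hilbertType R}.
Implicit Types (x y z : H) (a b c d e m M l : R) (X Y Z A B T S W P Q : bop H).
Implicit Types (p q : {poly R}) (f g : R -> R).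

Lemma pos_continuousM f g : pos_continuous f -> pos_continuous g ->
  pos_continuous (fun t => f t * g t).
Proof. by move=> fc gc x; apply: cvgM; [exact: fc|exact: gc]. Qed.

Lemma pos_continuousV f : (forall t, 0 < t -> 0 < f t) -> pos_continuous f ->
  pos_continuous (fun t => (f t)^-1).
Proof.
move=> f0 fc; apply/subspace_continuousP => x /[dup] x0.
rewrite /= in_itv/= andbT => x0'; apply: cvgV; first by rewrite gt_eqF ?f0.
by have /subspace_continuousP := fc; apply.
Qed.

Lemma pos_continuous_sqrt : pos_continuous (@Num.sqrt R).
Proof. by apply: continuous_subspaceT => x; exact: sqrt_continuous. Qed.

Lemma fcalc_sqrt X : op_gt0 X ->
  op_gt0 (fcalc Num.sqrt X) /\ fcalc Num.sqrt X * fcalc Num.sqrt X = X.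
Proof.
move=> X0; have [m [M [m0 mM XmM]]] := (op_gt0P X).1 X0.
split.
  apply: fcalc_op_gt0 => //; first exact: pos_continuous_sqrt.
  by move=> t; rewrite sqrtr_gt0.
have sc := pos_continuous_sqrt.
rewrite -fcalcM//; last exact: pos_continuousM.
apply: (fcalc_eq (op_gt0_is_adj X0)).
rewrite -{2}[X]poly_opX; apply: is_cfc_ext (is_cfc_poly 'X X).
move=> t /(spectrum_opin XmM)/andP[mt _]; rewrite hornerX -expr2 sqr_sqrtr//.
by rewrite ltW// (lt_le_trans m0).
Qed.

Lemma fcalcV f X : (forall t, 0 < t -> 0 < f t) -> pos_continuous f -> op_gt0 X ->
  fcalc (fun t => (f t)^-1) X = opinv (fcalc f X).
Proof.
move=> f0 fc X0; have [m [M [m0 mM XmM]]] := (op_gt0P X).1 X0.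
have gc := pos_continuousV f0 fc.
have f1 (g : R -> R) : (forall t, 0 < t -> g t = 1) -> fcalc g X = 1.
  move=> g1; apply: (fcalc_eq (op_gt0_is_adj X0)).
  have -> : (1 : bop H) = poly_op 1%:P X by rewrite poly_opC scale1r.
  apply: is_cfc_ext (is_cfc_poly _ X) => t /(spectrum_opin XmM)/andP[mt _].
  by rewrite hornerC g1// (lt_le_trans m0).
apply/esym/opinv_eq; rewrite -fcalcM//; do ?exact: pos_continuousM;
  by apply: f1 => t /f0 ft; rewrite ?mulfV ?mulVf ?gt_eqF.
Qed.

Lemma opin_scale m M X l : opin m M X -> 0 <= l -> opin (l * m) (l * M) (l%:C *: X).
Proof.
move=> [sX hX] l0; split; first exact: is_adjZ.
move=> x; rewrite bopZE ripZl -!mulrA; have /andP[h1 h2] := hX x.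
by rewrite !ler_wpM2l.
Qed.

Lemma opin_widen m M m' M' X : m' <= m -> M <= M' -> opin m M X -> opin m' M' X.
Proof.
move=> mm MM [sX hX]; split=> // x; have /andP[h1 h2] := hX x.
have x0 := ripxx_ge0 x.
by rewrite (le_trans _ h1) ?(le_trans h2)// ler_wpM2r.
Qed.

(** [q(l X)] is again a polynomial in [X], so the difference with [q(X)] is estimated on the
    spectrum. The lemma will remove the factors [1 - t] and [1 + e] from the monotonicity and Jensen
    arguments. *)
Lemma fcalc_scale_continuous f X e : pos_continuous f -> op_gt0 X -> 0 < e ->
  exists2 d, 0 < d & forall l, `|l - 1| <= d ->
    bop_bound (fcalc f (l%:C *: X) - fcalc f X) e.
Proof.
move=> fc /op_gt0P[m [M [m0 mM XmM]]] e0.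
have M0 : 0 < M by exact: lt_le_trans mM.
have m20 : 0 < m / 2 by rewrite divr_gt0.
have mM2 : m / 2 <= 2 * M by lra.
(* Six errors: two for replacing [f] by [q] in the operators, four within [q(l t) - q(t)]. *)
have e60 : 0 < e / 6 by rewrite divr_gt0.
have fc2 := pos_continuous_itv (M := 2 * M) m20 fc.
have [K K0 hK] := continuous_segment_quad mM2 fc2 e60.
have [q hq] := weierstrass mM2 fc2 e60.
have KM0 : 0 <= K * M ^+ 2 by rewrite mulr_ge0// sqr_ge0.
have KM1 : 0 < K * M ^+ 2 + 1 by lra.
(* The first bound keeps [l * t] in [m / 2, 2 M]; the second, as (l - 1)^2 <= |l - 1|, makes the
   quadratic term at most [e / 6]. *)
exists (Num.min (1 / 2) (e / 6 / (K * M ^+ 2 + 1))).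
  by rewrite lt_min !divr_gt0.
move=> l; rewrite le_min => /andP[l1 l2].
have {}l1 : 1 / 2 <= l <= 3 / 2 by move: l1; rewrite ler_norml => /andP[]; lra.
have l0 : 0 <= l by lra.
have lX : opin (m / 2) (2 * M) (l%:C *: X).
  by apply: opin_widen (opin_scale XmM l0); nra.
have wX : opin (m / 2) (2 * M) X by apply: opin_widen XmM; lra.
have b1 := fcalc_approx fc m20 mM2 lX (ltW e60) hq.
have b3 := fcalc_approx fc m20 mM2 wX (ltW e60) hq.
have b2 : bop_bound (poly_op q (l%:C *: X) - poly_op q X) (4 * (e / 6)).
  rewrite poly_op_scale -poly_opB; apply: poly_op_bound; first exact: XmM.1.
    lra.
  move=> t /(spectrum_opin XmM) /andP[mt tM].
  rewrite hornerD hornerN horner_comp hornerZ hornerX.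
  have t1 : m / 2 <= t <= 2 * M by lra.
  have t2 : m / 2 <= l * t <= 2 * M by apply/andP; split; nra.
  have u1 := hq _ t1; have u2 := hq _ t2; have u3 := hK _ _ t2 t1.
  have u4 : K * (l * t - t) ^+ 2 <= e / 6.
    have -> : l * t - t = (l - 1) * t by ring.
    have v1 : (l - 1) ^+ 2 <= `|l - 1|.
      rewrite -real_normK ?num_real// expr2 ler_piMl// ler_norml; lra.
    have v2 : t ^+ 2 <= M ^+ 2 by rewrite lerXn2r// nnegrE; lra.
    have v3 := ler_pM (sqr_ge0 (l - 1)) (sqr_ge0 t) v1 v2.
    have v4 := ler_wpM2l K0 v3.
    have v5 : `|l - 1| * (K * M ^+ 2 + 1) <= e / 6 by rewrite -ler_pdivlMr.
    have v6 := normr_ge0 (l - 1).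
    rewrite exprMn; lra.
  have := ler_distD (f (l * t)) q.[l * t] q.[t].
  have := ler_distD (f t) (f (l * t)) q.[t].
  rewrite (distrC (f t) q.[t]); lra.
have := bop_boundD (bop_boundD (bop_boundN b1) b2) b3.
rewrite opprB !addrA !subrK; apply: bop_bound_le; lra.
Qed.

Lemma op_gt0D X Y : op_gt0 X -> op_gt0 Y -> op_gt0 (X + Y).
Proof.
move=> /op_gt0P[m [M [m0 mM XmM]]] Y0.
have [c c0 hc] := bop_bounded (X + Y).
apply/op_gt0P; exists m, (c + m); split; rewrite ?lerDr//.
split; first by apply: is_adjD; [exact: XmM.1|exact: op_gt0_is_adj].
move=> x; have /andP[h1 h2] := XmM.2 x; have h3 := op_gt0_rip x Y0.
have h4 := rip_le_bound x hc; have h5 := mulr_ge0 (ltW m0) (ripxx_ge0 x).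
move: h4; rewrite bopDE ripDl => h4; apply/andP; split; lra.
Qed.

Lemma op_gt0Z c X : 0 < c -> op_gt0 X -> op_gt0 (c%:C *: X).
Proof.
move=> c0 /op_gt0P[m [M [m0 mM XmM]]]; apply/op_gt0P; exists (c * m), (c * M).
by split; [exact: mulr_gt0|rewrite ler_wpM2l// ltW|apply: opin_scale => //; exact: ltW].
Qed.

Lemma op_gt0_congr S W : is_adj S S -> invertible S -> op_gt0 W ->
  op_gt0 (S * W * S).
Proof.
move=> sS iS W0; have sW := op_gt0_is_adj W0; split; last first.
  by apply: invertibleM => //; apply: invertibleM => //; exact: W0.2.
apply/op_ge0P; split=> [|x]; last by rewrite !bopME sS; exact: op_gt0_rip.
by rewrite -{2}mulrA; apply: is_adjM => //; exact: is_adjM.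
Qed.

Lemma rip_sqr_le x y : rip x y ^+ 2 <= rip x x * rip y y.
Proof.
rewrite -!nrm_sqr -exprMn -real_normK ?num_real// lerXn2r ?nnegrE//.
  by rewrite mulr_ge0 ?nrm_ge0.
rewrite ler_norml rip_le_nrm andbT lerNl -ripNl -[nrm x]nrmN.
exact: rip_le_nrm.
Qed.

Lemma gmeanP P Q : op_gt0 P -> op_gt0 Q -> exists S T W,
  [/\ op_gt0 S /\ op_gt0 W, S * T = 1 /\ T * S = 1, S * S = P,
      W * W = T * Q * T & gmean P Q = S * W * S].
Proof.
move=> P0 Q0; have [S0 SS] := fcalc_sqrt P0.
have T0 := op_gt0_opinv S0; have sT := op_gt0_is_adj T0.
have [W0 WW] := fcalc_sqrt (op_gt0_congr sT T0.2 Q0).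
exists (fcalc Num.sqrt P), (opinv (fcalc Num.sqrt P)).
rewrite /gmean -!fcalcE; eexists.
by split; [split; [exact: S0|exact: W0]|exact: opinvP S0.2| |exact: WW|].
Qed.

Section GeometricMean.
Variables P Q : bop H.
Hypotheses (P0 : op_gt0 P) (Q0 : op_gt0 Q).

Lemma gmean_gt0 : op_gt0 (gmean P Q).
Proof.
have [S [T [W [[S0 W0] _ _ _ ->]]]] := gmeanP P0 Q0.
exact: op_gt0_congr (op_gt0_is_adj S0) S0.2 W0.
Qed.

(** [rip (gmean P Q x) y] becomes [rip (S x) (W (S y))], so that the comparison with the arithmetic
    mean is the positivity of a square and the off-diagonal bound is Cauchy-Schwarz. *)
Lemma gmean_sqrt_ex : exists S W,
  [/\ is_adj S S, is_adj W W, forall x, rip (S x) (S x) = rip (P x) x,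
      forall x, rip (W (S x)) (W (S x)) = rip (Q x) x & gmean P Q = S * W * S].
Proof.
have [S [T [W [[S0 W0] [ST TS] SS WW ->]]]] := gmeanP P0 Q0.
have sS := op_gt0_is_adj S0; have sW := op_gt0_is_adj W0.
exists S, W; split=> // x; first by rewrite -sS -bopME SS.
rewrite -sW -[W (W _)]bopME WW.
have -> : (T * Q * T) (S x) = (T * Q) x by rewrite -[in RHS](bop1E x) -TS.
have sT : is_adj T T.
  by rewrite -(opinv_eq ST TS); exact/op_gt0_is_adj/op_gt0_opinv.
by rewrite bopME sT -bopME TS.
Qed.

Lemma gmean_le_amean x :
  2 * rip (gmean P Q x) x <= rip (P x) x + rip (Q x) x.
Proof.
have [S [W [sS sW ripP ripQ ->]]] := gmean_sqrt_ex.
rewrite !bopME sS.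
have := ripxx_ge0 (W (S x) - S x); rewrite ripB2 ripP ripQ; lra.
Qed.

Lemma gmean_sqr_le x y :
  rip (gmean P Q x) y ^+ 2 <= rip (P x) x * rip (Q y) y.
Proof.
have [S [W [sS sW ripP ripQ ->]]] := gmean_sqrt_ex.
rewrite !bopME sS sW -ripP -ripQ; exact: rip_sqr_le.
Qed.

(* With [T = P^(-1/2)] and [V = W^-1], the difference between the inverses of
   the harmonic and of the geometric mean is [T (1 - V)^2 T / 2]. *)
Lemma hmean_le_gmean x :
  rip (opinv (2^-1 *: (opinv P + opinv Q)) x) x <= rip (gmean P Q x) x.
Proof.
have i2 : (2^-1 : R[i]) = (2^-1)%:C by rewrite fmorphV rmorph_nat.
have G0 := gmean_gt0.
have [S [T [W [[S0 W0] [ST TS] SS WW GE]]]] := gmeanP P0 Q0.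
have sT : is_adj T T.
  by rewrite -(opinv_eq ST TS); exact/op_gt0_is_adj/op_gt0_opinv.
have := op_gt0_is_adj (op_gt0_opinv W0); have [] := opinvP W0.2.
move: (opinv W) => V WV VW sV.
have GV : opinv (gmean P Q) = T * V * T.
  by rewrite GE; apply: opinv_eq; apply: mulr_sandwich.
have PT : opinv P = T * T.
  rewrite -SS; apply: opinv_eq.
    by have := mulr_sandwich ST (mulr1 1); rewrite !mulr1.
  by have := mulr_sandwich TS (mulr1 1); rewrite !mulr1.
have WV2 : (W * W) * (V * V) = 1.
  by have := mulr_sandwich WV (mulr1 1); rewrite !mulr1.
have VW2 : (V * V) * (W * W) = 1.
  by have := mulr_sandwich VW (mulr1 1); rewrite !mulr1.
have QT : opinv Q = T * (V * V) * T.
  have <- : S * (W * W) * S = Q.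
    by rewrite WW !mulrA ST mul1r -mulrA TS mulr1.
  by apply: opinv_eq; apply: mulr_sandwich.
rewrite -[gmean P Q]opinvK; last exact: G0.2.
apply: opinv_antitone.
- exact: op_gt0_opinv.
- by rewrite i2; apply: op_gt0Z; [rewrite invr_gt0|apply: op_gt0D; exact: op_gt0_opinv].
move=> y; rewrite GV PT QT i2 bopZE ripZl bopDE ripDl !bopME.
rewrite [rip (T (T y)) y]sT [rip (T (V (T y))) y]sT [rip (T (V (V _))) y]sT.
rewrite [rip (V (V _)) _]sV.
have := ripxx_ge0 (V (T y) - T y); rewrite ripB2; lra.
Qed.

End GeometricMean.

End OperatorMeans.

(** * Finite-rank operators *)

Section FiniteRank.
Context {R : realType} {H : hilbertType R}.
Implicit Types (x y z u v : H) (a b c d e : R) (k : R[i]).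

Lemma nrm_inner x y : Normc.normc (inner x y) <= nrm x * nrm y.
Proof.
set k := inner x y.
have k0 : 0 <= Normc.normc k by case: (k) => ? ?; exact: sqrtr_ge0.
(* The real inequality is applied to [x] and [k *: y], whose [rip] is the squared modulus of [k]. *)
have : Normc.normc k ^+ 2 <= nrm x * (Normc.normc k * nrm y).
  rewrite -nrmZC (le_trans _ (rip_le_nrm x (k *: y)))// /rip innerZr -/k.
  by case: (k) => p q /=; rewrite sqr_sqrtr ?addr_ge0 ?sqr_ge0//; lra.
have [->|kn0] := eqVneq (Normc.normc k) 0; first by rewrite mulr_ge0 ?nrm_ge0.
have kp : 0 < Normc.normc k by rewrite lt_neqAle eq_sym kn0.
by rewrite mulrCA expr2 ler_pM2l.
Qed.

Lemma rk1_bounded u v : (fun x => inner x u *: v) \in @bounded_linear R H.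
Proof.
apply/asboolP; split=> [k x y|].
  by rewrite innerDl innerZl scalerDl scalerA.
exists (nrm u * nrm v) => x; rewrite !normE -rmorphM/= lecR nrmZC.
by rewrite mulrAC [_ * nrm x]mulrC ler_wpM2r ?nrm_ge0 ?nrm_inner.
Qed.

Definition rk1 u v : bop H := Bop (rk1_bounded u v).

Lemma rk1E u v x : rk1 u v x = inner x u *: v. Proof. by []. Qed.

Lemma rk1_is_adj u v : is_adj (rk1 u v) (rk1 v u).
Proof.
apply/is_adjE => x y; rewrite !rk1E innerZl innerZr (innerC v y).
by rewrite mulrC.
Qed.

Definition orthonormal_family n (e : 'I_n -> H) :=
  forall i j, inner (e i) (e j) = (i == j)%:R.

Lemma orthonormal_extend n (e : 'I_n -> H) x : orthonormal_family e ->
  x <> \sum_(i < n) inner x (e i) *: e i ->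
  exists2 y, inner y y = 1 /\ (forall i, inner y (e i) = 0) &
    exists k, x = \sum_(i < n) inner x (e i) *: e i + k *: y.
Proof.
move=> oe xn; set w := x - \sum_(i < n) inner x (e i) *: e i.
have w0 : 0 < rip w w.
  rewrite lt_neqAle ripxx_ge0 andbT; apply/eqP => /esym/ripxx_eq0/eqP.
  by rewrite subr_eq0 => /eqP.
have nw0 : 0 < nrm w by rewrite sqrtr_gt0.
have we i : inner w (e i) = 0.
  rewrite /w innerDl -scaleN1r innerZl mulN1r.
  have -> : inner (\sum_j inner x (e j) *: e j) (e i) = inner x (e i).
    have -> : inner (\sum_j inner x (e j) *: e j) (e i) =
        \sum_j inner (inner x (e j) *: e j) (e i).
      elim/big_rec2: _ => [|j p q _ <-]; last by rewrite innerDl.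
      by rewrite -[0](scale0r (e i)) innerZl mul0r.
    rewrite (bigD1 i)//= big1 => [|j ji]; rewrite innerZl oe.
      by rewrite eqxx mulr1 addr0.
    by rewrite (negbTE ji) mulr0.
  by rewrite subrr.
exists ((nrm w)^-1%:C *: w); first split.
- rewrite innerxx ripZl ripZr -nrm_sqr.
  suff -> : (nrm w)^-1 * ((nrm w)^-1 * nrm w ^+ 2) = 1 by [].
  by field; rewrite gt_eqF.
- by move=> i; rewrite innerZl we mulr0.
exists (nrm w)%:C; rewrite scalerA -rmorphM mulfV ?gt_eqF// scale1r.
by rewrite /w addrC subrK.
Qed.

Lemma orthonormal_cons n (e : 'I_n -> H) y : orthonormal_family e ->
  inner y y = 1 -> (forall i, inner y (e i) = 0) ->
  orthonormal_family (fun i : 'I_n.+1 => oapp e y (unlift ord0 i)).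
Proof.
move=> oe yy ye i j.
have ey l : inner (e l) y = 0 by rewrite innerC ye conjc0.
case: unliftP => [i' ->|->]; case: unliftP => [j' ->|->] /=.
- by rewrite oe (inj_eq lift_inj).
- by rewrite ey.
- by rewrite ye.
- by rewrite yy.
Qed.

Lemma orthonormal_exists n : infinite_dimensional H ->
  exists e : 'I_n -> H, orthonormal_family e.
Proof.
move=> infH; elim: n => [|n [e oe]].
  by exists (fun=> 0) => -[].
have [x xn] := infH n e.
have [y [yy ye] _] := orthonormal_extend oe (xn (fun i => inner x (e i))).
by eexists; exact: (orthonormal_cons oe yy ye).
Qed.

Lemma orthonormal_span (s : seq H) : exists n (g : 'I_n -> H),
  orthonormal_family g /\
  forall x, x \in s -> x = \sum_(i < n) inner x (g i) *: g i.
Proof.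
elim: s => [|x s [n [g [og gs]]]].
  by exists 0%N, (fun=> 0); split=> // -[].
have [xE|/eqP xn] := eqVneq x (\sum_(i < n) inner x (g i) *: g i).
  by exists n, g; split=> // y; rewrite inE => /predU1P[->//|/gs].
have [y [yy yg] [k xk]] := orthonormal_extend og xn.
exists n.+1, (fun i => oapp g y (unlift ord0 i)); split.
  exact: orthonormal_cons.
have gy i : inner (g i) y = 0 by rewrite innerC yg conjc0.
have sumy (c : 'I_n -> R[i]) : inner (\sum_(i < n) c i *: g i) y = 0.
  elim/big_rec: _ => [|i z _ h]; first by rewrite -[0](scale0r y) innerZl mul0r.
  by rewrite innerDl innerZl gy h mulr0 addr0.
move=> z zs; rewrite big_ord_recl unlift_none/=.
under eq_bigr do rewrite liftK/=.
move: zs; rewrite inE => /predU1P[->|/gs zE]; last first.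
  by rewrite {2}zE sumy scale0r add0r.
rewrite {1}xk addrC; congr (_ *: _ + _).
by rewrite xk innerDl sumy add0r innerZl yy mulr1.
Qed.

End FiniteRank.

(** * From log-convexity to monotonicity *)

Section LogConvexity.
Context {R : realType} {H : hilbertType R}.
Implicit Types (x y z u v : H) (a b c d e : R) (X Y A B : bop H).
Variable f : R -> R.
Hypotheses (f_gt0 : forall t, 0 < t -> 0 < f t) (f_cont : pos_continuous f).

Let fgt0 X : op_gt0 X -> op_gt0 (fcalc f X).
Proof. exact: fcalc_op_gt0. Qed.

Lemma op_le_refl X : op_le X X.
Proof.
rewrite /op_le subrr; apply/op_ge0P; split=> [|x]; first exact: is_adj0.
by rewrite bop0E rip0l.
Qed.

Lemma half_complex : (2^-1 : R[i]) = (2^-1)%:C.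
Proof. by rewrite fmorphV rmorph_nat. Qed.

Lemma op_gt0_half X Y : op_gt0 X -> op_gt0 Y -> op_gt0 (2^-1 *: (X + Y)).
Proof.
by move=> X0 Y0; rewrite half_complex; apply: op_gt0Z; [rewrite invr_gt0|exact: op_gt0D].
Qed.

Lemma operator_log_convex_of_cstar :
  cstar_log_convex (@Kset R H f) -> operator_log_convex H f.
Proof.
move=> Kc X Y X0 Y0; rewrite -!fcalcE.
(* Both coefficients are the scalar 1 / sqrt 2. *)
have [C CZC aC] : exists2 C : bop H,
    forall Z, C * Z * C = 2^-1 *: Z & adjoint C = C.
  pose c : R := Num.sqrt 2^-1.
  exists (c%:C *: (1 : bop H)); last by apply: adjoint_eq; exact: is_adjZ is_adj1.
  move=> Z; rewrite scale_bopAl mul1r scale_bopAl scale_bopAr mulr1 scalerA.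
  by rewrite -rmorphM -expr2 sqr_sqrtr ?invr_ge0// half_complex.
have sum2 (F : 'I_2 -> bop H) : \sum_(i < 2) F i = F ord0 + F (lift ord0 ord0).
  by rewrite !big_ord_recl big_ord0 addr0.
have fX0 := fgt0 X0; have fY0 := fgt0 Y0.
have S0 := op_gt0_half X0 Y0.
have T0 := op_gt0_half (op_gt0_opinv fX0) (op_gt0_opinv fY0).
have ne : (lift ord0 ord0 == ord0 :> 'I_2) = false by [].
have half1 : 2^-1 *: (1 : bop H) + 2^-1 *: (1 : bop H) = 1.
  have h : 2^-1 + 2^-1 = 1 :> R by lra.
  by rewrite half_complex -scalerDl -rmorphD h scale1r.
have key (A B : bop H) : \sum_(i < 2)
    adjoint C * opinv (if i == ord0 then A else B) * C =
    2^-1 *: (opinv A + opinv B).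
  rewrite sum2 aC eqxx ne; move: (opinv A) (opinv B) => A' B'.
  by rewrite !CZC scalerDr.
(* The pairs [(X^-1, f(X))] and [(Y^-1, f(Y))] satisfy the defining inequality of the set with
   equality. *)
have [_ _ h] : Kset f (opinv (2^-1 *: (X + Y)),
    opinv (2^-1 *: (opinv (fcalc f X) + opinv (fcalc f Y)))).
  have := Kc 2%N (fun i => if i == ord0 then opinv X else opinv Y)
    (fun i => if i == ord0 then fcalc f X else fcalc f Y) (fun=> C).
  rewrite key (opinvK X0.2) (opinvK Y0.2) key sum2 aC; apply.
    move=> i; case: (i == ord0); split; rewrite -?fcalcE;
      try exact: op_gt0_opinv; try exact: fgt0.
      by rewrite /= (opinvK X0.2); exact: op_le_refl.
    by rewrite /= (opinvK Y0.2); exact: op_le_refl.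
  by have := CZC 1; rewrite mulr1 => ->.
have {h} : op_le (fcalc f (2^-1 *: (X + Y)))
    (opinv (2^-1 *: (opinv (fcalc f X) + opinv (fcalc f Y)))).
  by rewrite fcalcE -[X in cfc f X](opinvK S0.2).
move=> /op_leP h; apply/op_leP.
- exact/op_gt0_is_adj/fgt0.
- exact/op_gt0_is_adj/gmean_gt0.
move=> x; apply: (le_trans (h _ _ x)).
- exact/op_gt0_is_adj/fgt0.
- exact/op_gt0_is_adj/op_gt0_opinv.
exact: hmean_le_gmean.
Qed.

Hypothesis f_lc : operator_log_convex H f.

Lemma log_convex_gmean X Y : op_gt0 X -> op_gt0 Y -> exists G,
  [/\ is_adj G G, forall x, rip (fcalc f (2^-1 *: (X + Y)) x) x <= rip (G x) x,
    forall x, 2 * rip (G x) x <= rip (fcalc f X x) x + rip (fcalc f Y x) x &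
    forall x y, rip (G x) y ^+ 2 <= rip (fcalc f X x) x * rip (fcalc f Y y) y].
Proof.
move=> X0 Y0; have fX0 := fgt0 X0; have fY0 := fgt0 Y0.
have sG := op_gt0_is_adj (gmean_gt0 fX0 fY0).
exists (gmean (fcalc f X) (fcalc f Y)); split=> // [|x|x y].
- have := f_lc X0 Y0; rewrite -!fcalcE op_leP//.
  exact/op_gt0_is_adj/fgt0/op_gt0_half.
- exact: gmean_le_amean.
- exact: gmean_sqr_le.
Qed.

Lemma log_convex_midpoint X Y x : op_gt0 X -> op_gt0 Y ->
  2 * rip (fcalc f (2^-1 *: (X + Y)) x) x <=
    rip (fcalc f X x) x + rip (fcalc f Y x) x.
Proof.
move=> X0 Y0; have [G [_ h1 h2 _]] := log_convex_gmean X0 Y0.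
by have := h1 x; have := h2 x; lra.
Qed.

(** Repeated halving towards [X] produces these weights; that they tend to 0 is enough for Hansen's
    trick. *)
Lemma log_convex_mix X Y k x : op_gt0 X -> op_gt0 Y ->
  let t := (2^-1) ^+ k in
  op_gt0 ((1 - t)%:C *: X + t%:C *: Y) /\
  rip (fcalc f ((1 - t)%:C *: X + t%:C *: Y) x) x <=
    (1 - t) * rip (fcalc f X x) x + t * rip (fcalc f Y x) x.
Proof.
have hh : 2^-1 + 2^-1 = 1 :> R by lra.
move=> X0 Y0 /=; elim: k => [|k [IH0 IH]].
  by rewrite expr0 subrr scale0r scale1r add0r mul0r add0r mul1r.
set t := 2^-1 ^+ k in IH0 IH *.
have -> : (1 - 2^-1 ^+ k.+1)%:C *: X + (2^-1 ^+ k.+1)%:C *: Y =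
    2^-1 *: (X + ((1 - t)%:C *: X + t%:C *: Y)).
  rewrite half_complex exprS -/t !scalerDr !scalerA -!rmorphM/= addrA -scalerDl.
  by rewrite -rmorphD; congr (_%:C *: _ + _); rewrite mulrBr mulr1 addrA hh.
split; first exact: op_gt0_half.
have := log_convex_midpoint x X0 IH0; rewrite exprS -/t.
by move: IH; lra.
Qed.

Hypothesis infH : infinite_dimensional H.

(* The log-convexity inequality for the perturbations of the scalar [a] by [t]
   times the projections onto the lines of [w c s] and [w c (- s)], whose
   half-sum has the eigenvector [w 1 0] with eigenvalue [b]. *)
Lemma log_convex_growth a b d : 0 < a -> a < b -> 0 < d ->
  f b ^+ 2 * d <= (b + d - a) * f a * Num.max (f a) (f (b + d)).
Proof.
move=> a0 ab d0; have [t tE] : exists t, t = b + d - a by exists (b + d - a).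
rewrite -tE; have t0 : 0 < t by lra.
(* With [t = b + d - a] these weights satisfy [c ^+ 2 + s ^+ 2 = 1] and [a + t * c ^+ 2 = b]: the
   half-sum has eigenvalue [b], while the top eigenvalue of each perturbation is [b + d]. *)
pose s := Num.sqrt (d / t); pose c := Num.sqrt (1 - d / t).
have dt1 : d / t <= 1 by rewrite ler_pdivrMr//; lra.
have dt0 : 0 < d / t by rewrite divr_gt0.
have s2 : s ^+ 2 = d / t by rewrite sqr_sqrtr// ltW.
have c2 : c ^+ 2 = 1 - d / t by rewrite sqr_sqrtr// subr_ge0.
have [e oe] := orthonormal_exists 2 infH.
pose e0 := e ord0; pose e1 := e (lift ord0 ord0).
pose w (p q : R) : H := p%:C *: e0 + q%:C *: e1.
have wi p q p' q' : inner (w p q) (w p' q') = (p * p' + q * q')%:C.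
  have conjR (r : R) : Num.conj (r%:C : R[i]) = r%:C := conjc_real r.
  have oe' i j : inner (e i) (e j) = ((i == j)%:R : R)%:C by rewrite oe rmorph_nat.
  rewrite innerDl !innerZl !innerDr !innerZr !conjR /e0 /e1 !oe' -!rmorphM -!rmorphD.
  by rewrite -!rmorphM -!rmorphD /=; congr (_%:C); rewrite /=; ring.
have wD p q p' q' : w p q + w p' q' = w (p + p') (q + q').
  by rewrite /w addrACA -!scalerDl -!rmorphD.
have wZ r p q : r%:C *: w p q = w (r * p) (r * q).
  by rewrite /w scalerDr !scalerA -!rmorphM.
have wN p q : - w p q = w (- p) (- q).
  by rewrite /w opprD -!scaleNr -!rmorphN.
have wR p q p' q' : rip (w p q) (w p' q') = p * p' + q * q'.
  by rewrite /rip wi.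
pose proj (u : H) : bop H := a%:C *: (1 : bop H) + t%:C *: rk1 u u.
have opin_proj (u : H) : inner u u = 1 -> opin a (a + t) (proj u).
  move=> uu; have u1 : nrm u = 1.
    by rewrite /nrm /rip uu sqrtr1.
  split.
    by apply: is_adjD; apply: is_adjZ; [exact: is_adj1|exact: rk1_is_adj].
  move=> x; rewrite /proj bopDE !bopZE ripDl !ripZl bop1E.
  have -> : rip (rk1 u u x) x = Normc.normc (inner x u) ^+ 2.
    rewrite /rip rk1E innerZl [inner u x]innerC; case: (inner x u) => p q /=.
    by rewrite sqr_sqrtr ?addr_ge0 ?sqr_ge0//; lra.
  have h := nrm_inner x u; rewrite u1 mulr1 in h.
  have k0 : 0 <= Normc.normc (inner x u).
    by case: (inner x u) => ? ?; exact: sqrtr_ge0.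
  have h2 : Normc.normc (inner x u) ^+ 2 <= rip x x.
    by rewrite -nrm_sqr lerXn2r ?nnegrE ?nrm_ge0.
  have h3 := sqr_ge0 (Normc.normc (inner x u)).
  have h4 := ler_wpM2l (ltW t0) h2; have h5 := mulr_ge0 (ltW t0) h3.
  by rewrite mulrDl; apply/andP; split; lra.
have projA u x : inner u u = 1 -> inner x u = 0 ->
    fcalc f (proj u) x = (f a)%:C *: x.
  move=> /opin_proj uP xu; apply: (fcalc_eigen f_cont a0 _ uP); first by lra.
    by rewrite lexx/=; lra.
  by rewrite /proj bopDE !bopZE bop1E rk1E xu scale0r scaler0 addr0.
have projB u : inner u u = 1 -> fcalc f (proj u) u = (f (a + t))%:C *: u.
  move=> uu; have uP := opin_proj _ uu.
  apply: (fcalc_eigen f_cont a0 _ uP); first by lra.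
    by rewrite lexx andbT; lra.
  by rewrite /proj bopDE !bopZE bop1E rk1E uu scale1r -scalerDl -rmorphD.
pose E := w 1 0.
(* For [q = s] or [q = - s], [E] is [c] times a unit eigenvector for [f (a + t)] plus [q] times one
   for [f a]; both forms therefore equal [N] at [E]. *)
pose N := c ^+ 2 * f (a + t) + s ^+ 2 * f a.
have unitq (q : R) : q ^+ 2 = s ^+ 2 -> c * c + q * q = 1.
  by rewrite -!expr2 => ->; rewrite s2 c2; ring.
have unitw q : q ^+ 2 = s ^+ 2 -> inner (w c q) (w c q) = 1.
  by move=> qs; rewrite wi unitq.
have orthw q : inner (w q (- c)) (w c q) = 0.
  by rewrite wi mulNr [c * q]mulrC subrr.
have fE (q : R) : q ^+ 2 = s ^+ 2 -> rip (fcalc f (proj (w c q)) E) E = N.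
  move=> qs; have cq := unitq _ qs.
  have -> : E = c%:C *: w c q + q%:C *: w q (- c).
    by rewrite !wZ wD cq; congr (w _ _); ring.
  rewrite bop_linD !bop_linZ projB ?unitw// projA ?unitw ?orthw//.
  rewrite !wZ !wD wR /N -qs !expr2.
  have -> : c * q + q * - c = 0 by ring.
  by rewrite cq mulr1 mulr0 addr0; ring.
have fv q : q ^+ 2 = s ^+ 2 ->
    rip (fcalc f (proj (w c q)) (w q (- c))) (w q (- c)) = f a.
  move=> qs; rewrite projA ?unitw ?orthw// ripZl wR mulrNN addrC unitq//.
  exact: mulr1.
have sN : (- s) ^+ 2 = s ^+ 2 by rewrite sqrrN.
pose A := proj (w c s); pose B := proj (w c (- s)).
have Ain := opin_proj _ (unitw _ (erefl (s ^+ 2))).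
have Bin := opin_proj _ (unitw _ sN).
have at0 : a <= a + t by lra.
have A0 : op_gt0 A by apply/op_gt0P; exists a, (a + t).
have B0 : op_gt0 B by apply/op_gt0P; exists a, (a + t).
have [G [sG GE _ GS]] := log_convex_gmean A0 B0; move: GE => /(_ E) GE.
(* [w s (- c)] and [w (- s) (- c)] are eigenvectors for [f a], one of each operator, and differ by
   [2 s E]; the two off-diagonal bounds thus control [2 * s * rip (G E) E]. *)
have h1 : rip (G E) (w s (- c)) ^+ 2 <= f a * N.
  by have := GS (w s (- c)) E; rewrite fv// fE// sG ripC.
have h2 : rip (G E) (w (- s) (- c)) ^+ 2 <= f a * N.
  by have := GS E (w (- s) (- c)); rewrite fv// fE// mulrC.
have h3 : f b <= rip (G E) E.
  move: GE; rewrite (@fcalc_eigen _ _ _ _ _ _ f_cont a0 at0 _ b).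
  - by rewrite ripZl wR; lra.
  - split; first by rewrite half_complex; apply: is_adjZ; apply: is_adjD;
      [exact: Ain.1|exact: Bin.1].
    move=> x; rewrite half_complex bopZE ripZl bopDE ripDl.
    have /andP[? ?] := Ain.2 x; have /andP[? ?] := Bin.2 x.
    by apply/andP; split; lra.
  - by apply/andP; split; lra.
  rewrite half_complex bopZE bopDE /A /B /proj !bopDE !bopZE bop1E !rk1E !wi !wZ !wD wZ.
  have ct : t * c ^+ 2 = t - d by rewrite c2; field; rewrite gt_eqF.
  congr (w _ _); last by ring.
  have -> : b = a + t * c ^+ 2 by rewrite ct; lra.
  by field.
have h4 : s * f b <= s * rip (G E) E by rewrite ler_wpM2l// sqrtr_ge0.
have h5 : 2 * s * rip (G E) E = rip (G E) (w s (- c)) - rip (G E) (w (- s) (- c)).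
  have -> : w (- s) (- c) = w s (- c) - (2 * s)%:C *: E.
    by rewrite wZ wN wD; congr (w _ _); ring.
  by rewrite ripBr ripZr; ring.
have fb0 : 0 < f b by apply: f_gt0; lra.
have s0 : 0 <= s by exact: sqrtr_ge0.
have h6 : (s * f b) ^+ 2 <= f a * N.
  apply: (@le_trans _ _ ((s * rip (G E) E) ^+ 2)).
    by rewrite lerXn2r ?nnegrE// ?mulr_ge0// ?(ltW fb0)// (le_trans _ h3)// ltW.
  have -> : s * rip (G E) E = (rip (G E) (w s (- c)) - rip (G E) (w (- s) (- c))) / 2.
    by rewrite -h5; field.
  move: h1 h2; set p := rip _ _; set q := rip _ _ => h1 h2.
  have := sqr_ge0 (p + q); lra.
have h7 : N <= Num.max (f a) (f (a + t)).
  rewrite /N c2 s2; set F := Num.max _ _.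
  have F1 : f a <= F by rewrite le_max lexx.
  have F2 : f (a + t) <= F by rewrite le_max lexx orbT.
  have F3 := ler_wpM2l (ltW dt0) F1.
  have dt1' : 0 <= 1 - d / t by lra.
  have := ler_wpM2l dt1' F2; lra.
have fa0 := f_gt0 a0.
have h8 : (s * f b) ^+ 2 <= f a * Num.max (f a) (f (a + t)).
  by apply: (le_trans h6); rewrite ler_wpM2l// ltW.
have -> : b + d = a + t by lra.
have -> : f b ^+ 2 * d = t * (s * f b) ^+ 2.
  by rewrite exprMn s2; field; rewrite gt_eqF.
by rewrite -mulrA ler_wpM2l// ltW.
Qed.

Lemma log_convex_bounded a b : 0 < a -> a <= b -> f b <= 8 * f a.
Proof. exact: (quadratic_growth_bounded f_gt0 f_cont log_convex_growth). Qed.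

(* Write [(1 - t) B] as the mixture [(1 - t) A + t Y] with
   [Y = (1 - t) / t (B - A)]; since [f] is bounded at infinity, [t f(Y)]
   vanishes as [t] tends to [0]. *)
Lemma log_convex_decreasing A B e : op_gt0 A -> op_gt0 B -> 0 < e ->
  (forall x, rip (A x) x + e * rip x x <= rip (B x) x) ->
  forall x, rip (fcalc f B x) x <= rip (fcalc f A x) x.
Proof.
move=> A0 B0 e0 AB x; apply/ler_addgt0Pr => r r0.
pose K := rip (fcalc f A x) x + 8 * f e * rip x x + rip x x + 1.
have K1 := ripxx_ge0 x; have K2 := op_gt0_rip x (fgt0 A0).
have fe0 := f_gt0 e0.
have K3 : 0 <= 8 * f e * rip x x by rewrite !mulr_ge0// ltW.
have K0 : 0 < K by rewrite /K; lra.
have rK : 0 < r / K by rewrite divr_gt0.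
have [d d0 hd] := fcalc_scale_continuous f_cont B0 rK.
have half01 : 0 <= (2^-1 : R) < 1 by lra.
have md : 0 < Num.min d (r / K) by rewrite lt_min d0.
have [k0 /(_ k0.+1 (leqnSn _)) hk] := exprn_small half01 md.
have := log_convex_mix k0.+1 x A0; set t := 2^-1 ^+ k0.+1 in hk * => mix.
have t0 : 0 < t by rewrite exprn_gt0// invr_gt0.
have t1 : t <= 2^-1.
  by rewrite /t exprS ler_piMr ?invr_ge0// exprn_ile1 //; lra.
have [td tr] : t <= d /\ t <= r / K by move: hk; rewrite le_min => /andP[].
(* Since [t <= 2^-1], [q] is at least 1, so [Y >= B - A >= e] and [f(Y) <= 8 f(e)] independently of
   [t]. *)
pose q := (1 - t) / t.
have q1 : 1 <= q by rewrite /q ler_pdivlMr// mul1r; lra.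
pose Y := q%:C *: (B - A).
have [c c0 hc] := bop_bounded Y.
have Yin : opin e (c + e) Y.
  split; first by apply: is_adjZ; apply: is_adjB; exact: op_gt0_is_adj.
  move=> y; have y0 := ripxx_ge0 y; have yc := rip_le_bound y hc.
  apply/andP; split; last by rewrite mulrDl; have := mulr_ge0 (ltW e0) y0; lra.
  rewrite /Y bopZE ripZl bopBE ripBl; have := AB y => h.
  have h' : e * rip y y <= rip (B y) y - rip (A y) y by lra.
  apply: (le_trans h'); rewrite ler_peMl//; apply: le_trans h'.
  by rewrite mulr_ge0// ltW.
have ece : e <= c + e by rewrite lerDr.
have Y0 : op_gt0 Y by apply/op_gt0P; exists e, (c + e).
have [_] := mix Y Y0.
have -> : (1 - t)%:C *: A + t%:C *: Y = (1 - t)%:C *: B.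
  have tq : t * q = 1 - t by rewrite /q; field; rewrite gt_eqF.
  rewrite /Y scalerA -rmorphM tq.
  by rewrite -scalerDr [A + _]addrC subrK.
have fY : rip (fcalc f Y x) x <= 8 * f e * rip x x.
  apply: (fcalc_ub f_cont e0 ece Yin) => u /andP[eu _]; exact: log_convex_bounded.
have lt : `|1 - t - 1| <= d by rewrite addrAC subrr sub0r normrN ger0_norm// ltW.
have := rip_le_bound x (bop_boundN (hd _ lt)).
rewrite bopNE bopBE ripNl ripBl => h1 h2.
have h3 : t * rip (fcalc f Y x) x <= r / K * (8 * f e * rip x x).
  apply: (@le_trans _ _ (t * (8 * f e * rip x x))); first by rewrite ler_wpM2l// ltW.
  by rewrite ler_wpM2r.
have h4 : (1 - t) * rip (fcalc f A x) x <= rip (fcalc f A x) x.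
  by rewrite ler_piMl//; lra.
have h5 : r / K * (8 * f e * rip x x + rip x x) <= r.
  by rewrite mulrAC ler_pdivrMr// ler_wpM2l ?ltW// /K; lra.
lra.
Qed.

End LogConvexity.

(** * Dilations and Jensen's inequality *)

Section Dilation.
Context {R : realType} {H : hilbertType R}.
Implicit Types (x y z u v w : H) (a b c d e m M : R).

Lemma projection_rip (Q : bop H) y : is_adj Q Q -> (forall z, Q (Q z) = Q z) ->
  rip (y - Q y) (y - Q y) = rip y y - rip (Q y) y.
Proof. by move=> sQ QQ; rewrite ripB2 sQ QQ (ripC (Q y)); ring. Qed.

(* [W i] maps the range of the projection [P] isometrically onto mutually
   orthogonal subspaces. *)
Lemma orthogonal_copies n (D : 'I_n -> bop H) (s0 s : seq H) :
  infinite_dimensional H ->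
  exists (E P : bop H) (W W' : 'I_n -> bop H),
  [/\ [/\ is_adj E E, forall y, E (E y) = E y & forall y, y \in s0 -> E y = y],
      forall y, y \in s -> P y = y,
      forall i y, P (D i (E y)) = D i (E y),
      forall i, is_adj (W i) (W' i) &
      (forall i j y, W' j (W i y) = if i == j then P y else 0) /\
      forall i y, P (W' i y) = W' i y].
Proof.
move=> infH.
(* [E] projects onto the span of [s0]. The range of [P] is made to contain [s] and every
   [D i (E y)], and [e] supplies one vector for each pair of a copy and a basis vector of that
   range. *)
have [p [g [og gs]]] := orthonormal_span s0.
have [r [h [oh hs]]] :=
  orthonormal_span (s ++ [seq D ik.1 (g ik.2) | ik <- enum {: 'I_n * 'I_p}]).
have [e oe] := orthonormal_exists #|{: 'I_n * 'I_r}| infH.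
pose E := \sum_(k < p) rk1 (g k) (g k).
pose P := \sum_(k < r) rk1 (h k) (h k).
pose ee i k := e (enum_rank (i, k)).
have oee i k j l : inner (ee i k) (ee j l) = ((i == j) && (k == l))%:R.
  by rewrite oe (inj_eq enum_rank_inj).
pose W (i : 'I_n) := \sum_(k < r) rk1 (h k) (ee i k).
pose W' (i : 'I_n) := \sum_(k < r) rk1 (ee i k) (h k).
have PE y : P y = \sum_(k < r) inner y (h k) *: h k by rewrite /P bop_sumE.
have EE y : E y = \sum_(k < p) inner y (g k) *: g k by rewrite /E bop_sumE.
have WE i y : W i y = \sum_(k < r) inner y (h k) *: ee i k by rewrite /W bop_sumE.
have W'E i y : W' i y = \sum_(k < r) inner y (ee i k) *: h k by rewrite /W' bop_sumE.
have Eg k : E (g k) = g k.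
  rewrite EE (bigD1 k)//= big1 => [|l /negbTE lk]; last first.
    by rewrite og eq_sym lk scale0r.
  by rewrite og eqxx scale1r addr0.
have Ph k : P (h k) = h k.
  rewrite PE (bigD1 k)//= big1 => [|l /negbTE lk]; last first.
    by rewrite oh eq_sym lk scale0r.
  by rewrite oh eqxx scale1r addr0.
exists E, P, W, W'; split.
- split.
  + by apply: is_adj_sum => k; exact: rk1_is_adj.
  + move=> y; rewrite [in LHS](EE y) bop_lin_sum [RHS]EE; apply: eq_bigr => k _.
    by rewrite bop_linZ Eg.
  + by move=> y ys; rewrite EE -gs.
- by move=> y ys; rewrite PE -hs// mem_cat ys.
- move=> i y; rewrite EE !bop_lin_sum; apply: eq_bigr => k _.
  rewrite !bop_linZ; congr (_ *: _); rewrite PE -hs//.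
  rewrite mem_cat; apply/orP; right; apply/mapP; exists (i, k) => //.
  by rewrite mem_enum.
- by move=> i; apply: is_adj_sum => k; exact: rk1_is_adj.
split=> [i j y|i y]; last first.
  by rewrite W'E bop_lin_sum; apply: eq_bigr => k _; rewrite bop_linZ Ph.
have We k : W' j (ee i k) = if i == j then h k else 0.
  rewrite W'E; case: eqVneq => [<-|ij]; last first.
    by rewrite big1// => l' _; rewrite oee (negbTE ij) scale0r.
  rewrite (bigD1 k)//= big1 => [|l' /negbTE lk]; last first.
    by rewrite oee eq_sym lk andbF scale0r.
  by rewrite oee !eqxx scale1r addr0.
rewrite WE bop_lin_sum; under eq_bigr do rewrite bop_linZ We.
by case: eqP => _; [rewrite PE|rewrite big1// => k _; rewrite scaler0].
Qed.

(** The finite-rank maps of the dilation are built to intertwine at finitely many vectors; a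
    polynomial sees no more than the powers below its size. *)
Lemma poly_op_intertwine (T S W : bop H) (q : {poly R}) x :
  (forall k, (k < size q)%N -> T (W ((S ^+ k) x)) = W ((S ^+ k.+1) x)) ->
  poly_op q T (W x) = W (poly_op q S x).
Proof.
move=> TW; have Tk k : (k <= size q)%N -> (T ^+ k) (W x) = W ((S ^+ k) x).
  elim: k => [|k IH] kq; first by rewrite !expr0 !bop1E.
  by rewrite exprS bopME IH ?TW// ltnW.
rewrite /poly_op !bop_sumE bop_lin_sum; apply: eq_bigr => k _.
by rewrite !bopZE bop_linZ Tk// ltnW.
Qed.

(** Positivity at [(e / 2)%:C *: y - z], multiplied by [2 / e]. Cross terms are absorbed at the
    price of a factor close to 1 on [y] and a large one on [z]. *)
Lemma psd_cross_term (T : bop H) e y z : is_adj T T ->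
  (forall u, 0 <= rip (T u) u) -> 0 < e ->
  rip (T (y + z)) (y + z) <=
    (1 + e / 2) * rip (T y) y + (1 + 2 / e) * rip (T z) z.
Proof.
move=> sT T0 e0; have := T0 ((e / 2)%:C *: y - z).
rewrite bop_linB bop_linZ ripBl !ripBr !ripZl !ripZr.
rewrite bop_linD ripDl !ripDr (sT z y) (ripC z).
set a := rip _ _; set b := rip _ _; set c := rip _ _ => h.
have {}h : 0 <= (2 / e) * (e / 2 * (e / 2 * a) - e / 2 * b - (e / 2 * b - c)).
  by rewrite mulr_ge0// divr_ge0// ltW.
suff <- : (2 / e) * (e / 2 * (e / 2 * a) - e / 2 * b - (e / 2 * b - c)) +
    (a + b + (b + c)) = (1 + e / 2) * a + (1 + 2 / e) * c by rewrite lerDr.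
by field; rewrite gt_eqF.
Qed.

Section Compression.
Variables (n : nat) (A D D' : 'I_n -> bop H).
Hypotheses (DD' : forall i, is_adj (D i) (D' i)).
Hypothesis D1 : \sum_(i < n) D' i * D i = 1.
Let B := \sum_(i < n) D' i * A i * D i.

Lemma rip_compression y : rip (B y) y = \sum_(i < n) rip (A i (D i y)) (D i y).
Proof.
rewrite /B bop_sumE rip_suml; apply: eq_bigr => i _.
by rewrite (is_adj_sym (DD' i)).
Qed.

Lemma rip_isometry y : \sum_(i < n) rip (D i y) (D i y) = rip y y.
Proof.
rewrite -[X in _ = rip X _](bop1E y) -D1 bop_sumE rip_suml.
by apply: eq_bigr => i _; rewrite (is_adj_sym (DD' i)).
Qed.

Lemma compression_opin m M : (forall i, opin m M (A i)) -> opin m M B.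
Proof.
move=> AmM; split.
  apply: is_adj_sum => i; rewrite -{1}mulrA; apply: is_adjM; first exact/is_adj_sym/DD'.
  by apply: is_adjM; [exact: (AmM i).1|exact: DD'].
move=> y; rewrite rip_compression -rip_isometry !mulr_sumr; apply/andP.
by split; apply: ler_sum => i _; have /andP[] := (AmM i).2 (D i y).
Qed.

End Compression.

(** [T] carries a compression of [A i] on the copy of index [i] and is [m] on the complement; [V]
    sends [x] to the sum of the copies of the [D i x]. [S] is block-diagonal: a compression of
    [(1 + e) B] on the range of [V], and [N] on its complement. By [psd_cross_term], [T] is below
    [(1 + e / 2) B] and [(1 + 2 / e) M] on these blocks. The gap [e / 2 * m] is paid by the other
    [e / 2 * B] on the first block, as [B >= m], and by the last term of [N] on the second. *)
Lemma dilation_compression n (A D D' : 'I_n -> bop H) m M e x (d : nat) :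
  infinite_dimensional H -> 0 < m -> m <= M -> 0 < e ->
  (forall i, opin m M (A i)) -> (forall i, is_adj (D i) (D' i)) ->
  \sum_(i < n) D' i * D i = 1 ->
  let B := \sum_(i < n) D' i * A i * D i in
  let N := (1 + 2 / e) * M + e / 2 * m in
  exists (T S V : bop H) (W : 'I_n -> bop H),
  [/\ [/\ opin m M T, opin m ((1 + e) * M + N) S &
        forall y, rip (T y) y + e / 2 * m * rip y y <= rip (S y) y],
      V x = \sum_(i < n) W i (D i x),
      forall i k, (k < d)%N ->
        T (W i ((A i ^+ k) (D i x))) = W i ((A i ^+ k.+1) (D i x)),
      forall i u, rip (W i u) (V x) = rip u (D i x) &
      (forall k, (k < d)%N -> S (V ((((1 + e)%:C *: B) ^+ k) x)) =
         V ((((1 + e)%:C *: B) ^+ k.+1) x)) /\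
      forall u, rip (V u) (V x) = rip u x].
Proof.
move=> infH m0 mM e0 AmM DD' D1 B N.
have M0 : 0 < M by exact: lt_le_trans mM.
pose C := (1 + e)%:C *: B.
(* These lists make [E] fix the powers of [C] at [x], and [P] those of [A i] at [D i x], for
   exponents below [d]. *)
pose s0 := x :: [seq (C ^+ k) x | k <- iota 0 d].
pose s := [seq (A ik.1 ^+ ik.2) (D ik.1 x) | ik <- [seq (i, k) | i <- enum 'I_n,
  k <- iota 0 d]].
have [E [P [W [W' [[sE EE Es0] Ps PDE WW' [W'W PW']]]]]] :=
  orthogonal_copies D s0 s infH.
have Ex : E x = x by apply: Es0; rewrite mem_head.
have EC k : (k < d)%N -> E ((C ^+ k) x) = (C ^+ k) x.
  move=> kd; apply: Es0; rewrite inE; apply/orP; right.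
  by apply/mapP; exists k; rewrite ?mem_iota.
have PA i k : (k < d)%N -> P ((A i ^+ k) (D i x)) = (A i ^+ k) (D i x).
  move=> kd; apply: Ps; apply/mapP; exists (i, k) => //.
  by apply/allpairsP; exists (i, k); rewrite mem_enum mem_iota.
have W'Wii i y : W' i (W i y) = P y by rewrite W'W eqxx.
have W'Wij i j y : j != i -> W' j (W i y) = 0.
  by rewrite W'W eq_sym => /negbTE ->.
have D1E y : \sum_(i < n) D' i (D i y) = y by rewrite -[RHS](bop1E y) -D1 bop_sumE.
have ripB' y : rip (B y) y = \sum_(i < n) rip (A i (D i y)) (D i y).
  exact: rip_compression.
have [sB BmM] := compression_opin DD' D1 AmM.
pose Q := \sum_(i < n) W i * W' i.
have QE y : Q y = \sum_(i < n) W i (W' i y) by rewrite /Q bop_sumE.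
have sQ : is_adj Q Q.
  by apply: is_adj_sum => i; apply: is_adjM; [exact: WW'|exact/is_adj_sym/WW'].
have QW i y : P y = y -> Q (W i y) = W i y.
  move=> Py; rewrite QE (bigD1 i)//= W'Wii Py big1 ?addr0// => j ji.
  by rewrite W'Wij// bop_lin0.
have QQ y : Q (Q y) = Q y.
  by rewrite [in LHS](QE y) bop_lin_sum [RHS]QE; apply: eq_bigr => i _; rewrite QW.
have ripQ y : rip (Q y) y = \sum_(i < n) rip (W' i y) (W' i y).
  by rewrite QE rip_suml; apply: eq_bigr => i _; rewrite WW'.
pose T := \sum_(i < n) W i * A i * W' i + m%:C *: (1 - Q).
have TE y : T y = \sum_(i < n) W i (A i (W' i y)) + m%:C *: (y - Q y).
  by rewrite /T bopDE bop_sumE bopZE bopBE bop1E.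
have sT : is_adj T T.
  apply: is_adjD; last by apply: is_adjZ; exact: is_adjB.
  apply: is_adj_sum => i; rewrite -{1}mulrA; apply: is_adjM; first exact: WW'.
  by apply: is_adjM; [exact: (AmM i).1|exact/is_adj_sym/WW'].
have TW i y : P y = y -> T (W i y) = W i (A i y).
  move=> Py; rewrite TE QW// subrr scaler0 addr0 (bigD1 i)//= W'Wii Py.
  by rewrite big1 ?addr0// => j ji; rewrite W'Wij// !bop_lin0.
have TmM : opin m M T.
  split=> // y; rewrite TE ripDl ripZl rip_suml ripBl.
  have -> : \sum_(i < n) rip (W i (A i (W' i y))) y =
      \sum_(i < n) rip (A i (W' i y)) (W' i y).
    by apply: eq_bigr => i _; rewrite WW'.
  have h1 : m * rip (Q y) y <= \sum_(i < n) rip (A i (W' i y)) (W' i y).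
    by rewrite ripQ mulr_sumr; apply: ler_sum => i _; have /andP[] := (AmM i).2 (W' i y).
  have h2 : \sum_(i < n) rip (A i (W' i y)) (W' i y) <= M * rip (Q y) y.
    by rewrite ripQ mulr_sumr; apply: ler_sum => i _; have /andP[] := (AmM i).2 (W' i y).
  have h3 : 0 <= rip y y - rip (Q y) y by rewrite -projection_rip// ripxx_ge0.
  have h4 := ler_wpM2r h3 mM.
  by apply/andP; split; lra.
(* [V] is a partial isometry with adjoint [V']: since [P] fixes [D i (E y)], [V' * V] is [E]. *)
pose V := \sum_(i < n) W i * D i * E.
pose V' := \sum_(i < n) E * D' i * W' i.
have VE y : V y = \sum_(i < n) W i (D i (E y)) by rewrite /V bop_sumE.
have V'E y : V' y = \sum_(i < n) E (D' i (W' i y)) by rewrite /V' bop_sumE.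
have VV' : is_adj V V'.
  apply: is_adj_sum => i; rewrite -[X in is_adj _ X]mulrA; apply: is_adjM => //.
  by apply: is_adjM; [exact: WW'|exact: DD'].
have W'V i y : W' i (V y) = D i (E y).
  rewrite VE bop_lin_sum (bigD1 i)//= W'Wii PDE big1 ?addr0// => j ji.
  by rewrite W'Wij// eq_sym.
have V'V y : V' (V y) = E y.
  rewrite V'E; under eq_bigr do rewrite W'V.
  by rewrite -bop_lin_sum D1E EE.
have EV' y : E (V' y) = V' y.
  by rewrite V'E bop_lin_sum; apply: eq_bigr => i _; rewrite EE.
have VEy y : V (E y) = V y by rewrite !VE EE.
have TVV y : E y = y -> rip (T (V y)) (V y) = rip (B y) y.
  move=> Ey; rewrite [in T _]VE bop_lin_sum rip_suml ripB'.
  apply: eq_bigr => i _; rewrite TW ?PDE// WW' W'V.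
  by rewrite Ey.
pose S := V * C * V' + N%:C *: (1 - V * V').
have SE y : S y = V (C (V' y)) + N%:C *: (y - V (V' y)).
  by rewrite /S bopDE bopZE bopBE bop1E !bopME.
have sVV' : is_adj (V * V') (V * V').
  by apply: is_adjM => //; exact/is_adj_sym.
have sC : is_adj C C by exact: is_adjZ.
have sS : is_adj S S.
  apply: is_adjD; last by apply: is_adjZ; exact: is_adjB.
  rewrite -{1}mulrA; apply: is_adjM => //.
  by apply: is_adjM => //; exact/is_adj_sym.
have ripVV' y : rip (V (V' y)) y = rip (V' y) (V' y) by rewrite VV'.
have ripz y : rip (y - V (V' y)) (y - V (V' y)) = rip y y - rip (V' y) (V' y).
  rewrite -ripVV'; apply: (projection_rip (Q := V * V')) => // z.
  by rewrite !bopME V'V VEy.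
have ripS y : rip (S y) y =
    (1 + e) * rip (B (V' y)) (V' y) + N * (rip y y - rip (V' y) (V' y)).
  by rewrite SE ripDl !ripZl VV' /C bopZE ripZl ripBl ripVV'.
(* [y] is split along the range of [V] and its orthogonal complement. *)
have gap y : rip (T y) y + e / 2 * m * rip y y <= rip (S y) y.
  have Tpos u : 0 <= rip (T u) u.
    by have /andP[+ _] := TmM.2 u; apply/le_trans/mulr_ge0; rewrite ?ripxx_ge0 ?ltW.
  have := psd_cross_term (V (V' y)) (y - V (V' y)) sT Tpos e0.
  rewrite addrC subrK TVV ?EV'// ripS => h1.
  have /andP[_ h2] := TmM.2 (y - V (V' y)); rewrite ripz in h2.
  have h3 : 0 <= rip y y - rip (V' y) (V' y) by rewrite -ripz ripxx_ge0.
  have /andP[h4 _] := BmM (V' y).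
  have e2 : 0 < 1 + 2 / e by rewrite ltr_wpDl// ?ler01// divr_gt0.
  have h5 := ler_wpM2l (ltW e2) h2.
  have h6 := ler_wpM2l (ltW (divr_gt0 e0 (ltr0n R 2))) h4.
  rewrite /N; move: h1 h5 h6.
  move: (rip _ _) (rip _ _) (rip _ _) (rip _ _) (rip _ _) => t1 t2 t3 t4 t5.
  lra.
exists T, S, V, W; split.
- split=> //; split=> // y; apply/andP; split.
    have /andP[h1 _] := TmM.2 y.
    have h2 : 0 <= e / 2 * m * rip y y.
      by rewrite !mulr_ge0 ?ripxx_ge0// ?divr_ge0// ltW.
    by have := gap y; lra.
  rewrite ripS; have h3 : 0 <= rip y y - rip (V' y) (V' y).
    by rewrite -ripz ripxx_ge0.
  have /andP[_ h4] := BmM (V' y).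
  have N0 : 0 <= N.
    by rewrite addr_ge0// mulr_ge0 ?addr_ge0 ?divr_ge0// ltW.
  have e1 : 0 <= 1 + e by rewrite addr_ge0// ltW.
  have h5 := ler_wpM2l e1 h4.
  have h6 : 0 <= N * rip (V' y) (V' y) by rewrite mulr_ge0// ripxx_ge0.
  have h7 : 0 <= (1 + e) * M * (rip y y - rip (V' y) (V' y)).
    by rewrite !mulr_ge0// ltW.
  lra.
- by rewrite VE Ex.
- by move=> i k kd; rewrite TW ?PA// exprS bopME.
- by move=> i u; rewrite WW' W'V Ex.
split=> [k kd|u].
  by rewrite exprS bopME SE V'V EC// subrr scaler0 addr0.
by rewrite VV' V'V Ex.
Qed.

End Dilation.

(** * Jensen's operator inequality for the reciprocal of f *)

Section Jensen.
Context {R : realType} {H : hilbertType R}.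
Implicit Types (x y z u v w : H) (a b c d e m M : R).
Variable f : R -> R.
Hypotheses (f_gt0 : forall t, 0 < t -> 0 < f t) (f_cont : pos_continuous f).
Hypothesis f_lc : operator_log_convex H f.
Hypothesis infH : infinite_dimensional H.

Let h t := (f t)^-1.
Let h_cont : pos_continuous h. Proof. exact: pos_continuousV. Qed.
Let fgt0 (X : bop H) : op_gt0 X -> op_gt0 (fcalc f X).
Proof. exact: fcalc_op_gt0. Qed.

Lemma bop_bound_rip (P F : bop H) e y : bop_bound (P - F) e ->
  rip (P y) y <= rip (F y) y + e * rip y y /\
  rip (F y) y <= rip (P y) y + e * rip y y.
Proof.
move=> b; have h1 := rip_le_bound y b.
have h2 := rip_le_bound y (bop_boundN b).
move: h1 h2; rewrite bopNE bopBE ripNl ripBl; lra.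
Qed.

Lemma inv_log_convex_increasing (A B : bop H) e x : op_gt0 A -> op_gt0 B ->
  0 < e -> (forall y, rip (A y) y + e * rip y y <= rip (B y) y) ->
  rip (fcalc h A x) x <= rip (fcalc h B x) x.
Proof.
move=> A0 B0 e0 AB; rewrite !fcalcV//; apply: opinv_antitone; try exact: fgt0.
exact: (log_convex_decreasing f_gt0 f_cont f_lc infH A0 B0 e0 AB).
Qed.

Section Compression.
Variables (n : nat) (A D D' : 'I_n -> bop H) (m M : R).
Hypotheses (m0 : 0 < m) (mM : m <= M) (AmM : forall i, opin m M (A i)).
Hypothesis DD' : forall i, is_adj (D i) (D' i).
Hypothesis D1 : \sum_(i < n) D' i * D i = 1.
Let B := \sum_(i < n) D' i * A i * D i.

(** For a polynomial [q] close to [h], the form of [q(T)] at [V x] is the sum over the [q(A i)], and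
    that of [q(S)] is the form of [q((1 + e) B)] at [x]. Monotonicity of [h] compares [T] with
    [S]. *)
Lemma jensen_scaled e x : 0 < e ->
  \sum_(i < n) rip (fcalc h (A i) (D i x)) (D i x) <=
    rip (fcalc h ((1 + e)%:C *: B) x) x.
Proof.
move=> e0; apply/ler_addgt0Pr => r r0.
have M0 : 0 < M by exact: lt_le_trans mM.
have x0 := ripxx_ge0 x.
(* [h] is replaced by [q] four times: in the [A i], in [T], in [S] and in [(1 + e) B]. *)
pose s := 4 * rip x x + 1; have s0 : 0 < s by rewrite /s ltr_wpDl// mulr_ge0.
pose N := (1 + 2 / e) * M + e / 2 * m.
have N0 : 0 <= N by rewrite addr_ge0// mulr_ge0 ?addr_ge0 ?divr_ge0// ltW.
have [M' M'E] : exists M', M' = (1 + e) * M + N by eexists.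
have eM0 : 0 <= e * M by rewrite mulr_ge0// ltW.
have MM' : M <= M' by rewrite M'E mulrDl; lra.
have mM' := le_trans mM MM'.
have [q hq] := weierstrass mM' (pos_continuous_itv m0 h_cont) (divr_gt0 r0 s0).
have re0 : 0 <= r / s by rewrite divr_ge0// ltW.
have approx (X : bop H) : opin m M' X -> bop_bound (poly_op q X - fcalc h X) (r / s).
  by move=> Xin; apply: (fcalc_approx h_cont m0 mM' Xin).
have [T [S [V [W [[Tin Sin TS] VE TW WV [SV VV]]]]]] :=
  dilation_compression x (size q) infH m0 mM e0 AmM DD' D1.
have [sB Bin] := compression_opin DD' D1 AmM.
have Cin : opin m M' ((1 + e)%:C *: B).
  have e1 : 0 <= 1 + e by rewrite addr_ge0// ltW.
  apply: opin_widen (opin_scale (conj sB Bin) e1); last by rewrite M'E lerDl.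
  by rewrite mulrDl mul1r lerDl mulr_ge0// ltW.
rewrite -/N -M'E in Sin.
have Tin' : opin m M' T by apply: opin_widen Tin.
have qT : rip (poly_op q T (V x)) (V x) =
    \sum_(i < n) rip (poly_op q (A i) (D i x)) (D i x).
  rewrite [X in poly_op q T X]VE bop_lin_sum rip_suml; apply: eq_bigr => i _.
  by rewrite (poly_op_intertwine (S := A i)) ?WV// => k; exact: TW.
have qS : rip (poly_op q S (V x)) (V x) = rip (poly_op q ((1 + e)%:C *: B) x) x.
  by rewrite (poly_op_intertwine SV) VV.
have [_ b1] := bop_bound_rip x (approx _ Cin).
have [b1' _] := bop_bound_rip x (approx _ Cin).
have [b2 _] := bop_bound_rip (V x) (approx _ Tin').
have [_ b3] := bop_bound_rip (V x) (approx _ Sin).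
have b4 : \sum_(i < n) rip (fcalc h (A i) (D i x)) (D i x) <=
    \sum_(i < n) rip (poly_op q (A i) (D i x)) (D i x) + r / s * rip x x.
  rewrite -(rip_isometry DD' D1) mulr_sumr -big_split/=; apply: ler_sum => i _.
  have Ain : opin m M' (A i) by apply: opin_widen (AmM i).
  by have [] := bop_bound_rip (D i x) (approx _ Ain).
have em0 : 0 < e / 2 * m by rewrite mulr_gt0// divr_gt0.
have T0 : op_gt0 T by apply/op_gt0P; exists m, M.
have S0 : op_gt0 S by apply/op_gt0P; exists m, M'.
have b5 := inv_log_convex_increasing (V x) T0 S0 em0 TS.
rewrite qT VV in b2; rewrite qS VV in b3.
have : r / s * (4 * rip x x) <= r.
  by rewrite mulrAC ler_pdivrMr// ler_wpM2l ?ltW// /s ltrDl.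
lra.
Qed.

(** The factor [1 + e] disappears as [e] tends to 0, by continuity under scaling. *)
Lemma jensen x :
  \sum_(i < n) rip (fcalc h (A i) (D i x)) (D i x) <= rip (fcalc h B x) x.
Proof.
apply/ler_addgt0Pr => r r0; have x0 := ripxx_ge0 x.
pose s := rip x x + 1; have s0 : 0 < s by rewrite /s ltr_wpDl.
have B0 : op_gt0 B.
  by apply/op_gt0P; exists m, M; split=> //; exact: compression_opin.
have [d d0 hd] := fcalc_scale_continuous h_cont B0 (divr_gt0 r0 s0).
have hd' := hd (1 + d); rewrite addrAC subrr add0r in hd'.
have dd : `|d| <= d by rewrite ger0_norm// ltW.
have [b _] := bop_bound_rip x (hd' dd).
have := jensen_scaled x d0.
have : r / s * rip x x <= r.
  by rewrite mulrAC ler_pdivrMr// ler_wpM2l ?ltW// /s ltrDl.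
lra.
Qed.

End Compression.

(** Sums instead of extrema also cover the empty family: the inverse of 1 plus the sum of the
    inverse lower bounds lies below each of them. *)
Lemma common_opin n (A : 'I_n -> bop H) : (forall i, op_gt0 (A i)) ->
  exists m M, [/\ 0 < m, m <= M & forall i, opin m M (A i)].
Proof.
move=> /(_ _)/op_gt0P A0.
have /choice[mM hmM] : forall i, exists p : R * R,
    [/\ 0 < p.1, p.1 <= p.2 & opin p.1 p.2 (A i)].
  by move=> i; have [m [M ?]] := A0 i; exists (m, M).
pose s := \sum_(i < n) ((mM i).1)^-1 + 1.
have mi i : 0 < (mM i).1 by have [] := hmM i.
have s0 : 0 < s.
  by rewrite /s ltr_wpDl// sumr_ge0// => i _; rewrite invr_ge0 ltW.
exists s^-1, (\sum_(i < n) (mM i).2 + s^-1).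
have Mi i : 0 <= (mM i).2 by have [a b _] := hmM i; rewrite (le_trans (ltW a)).
split; rewrite ?invr_gt0 ?lerDr ?sumr_ge0// => i.
have [_ _ Ai] := hmM i; apply: opin_widen Ai.
  rewrite -[leRHS]invrK lef_pV2 ?posrE ?invr_gt0// /s (bigD1 i)//= -addrA lerDl.
  by rewrite addr_ge0// sumr_ge0// => j _; rewrite invr_ge0 ltW.
rewrite (bigD1 i)//= -addrA lerDl addr_ge0 ?invr_ge0 ?(ltW s0)//.
by rewrite sumr_ge0.
Qed.

Lemma cstar_of_operator_log_convex : cstar_log_convex (@Kset R H f).
Proof.
move=> n X Y C XY C1.
(* [D i] is [C i] when [adjoint (C i)] is a true adjoint, and 0 when it is the default 0; the sums
   do not change. *)
have /choice[D hD] : forall i, exists D : bop H, is_adj D (adjoint (C i)) /\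
    forall Z, adjoint (C i) * Z * C i = adjoint (C i) * Z * D.
  move=> i; have [?|->] := adjointP (C i); first by exists (C i).
  by exists 0; split=> [|Z]; [exact: is_adj0|rewrite !mul0r].
have DD' i : is_adj (D i) (adjoint (C i)) by case: (hD i).
have D1 : \sum_(i < n) adjoint (C i) * D i = 1.
  rewrite -C1; apply: eq_bigr => i _.
  by have [_ /(_ 1)] := hD i; rewrite !mulr1.
have X0 i : op_gt0 (X i) by case: (XY i).
have Y0 i : op_gt0 (Y i) by case: (XY i).
have fXY i : op_le (fcalc f (opinv (X i))) (Y i) by rewrite fcalcE; case: (XY i).
have DE (Z A : 'I_n -> bop H) : (forall i, opinv (Z i) = A i) ->
    \sum_(i < n) adjoint (C i) * opinv (Z i) * C i =
    \sum_(i < n) adjoint (C i) * A i * D i.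
  move=> ZA; apply: eq_bigr => i _; rewrite ZA.
  by case: (hD i) => _ ->.
have [A XA] : exists A, forall i, opinv (X i) = A i by exists (opinv \o X).
have [Z YZ] : exists Z, forall i, opinv (Y i) = Z i by exists (opinv \o Y).
have A0 i : op_gt0 (A i) by rewrite -XA; exact: op_gt0_opinv.
have Z0 i : op_gt0 (Z i) by rewrite -YZ; exact: op_gt0_opinv.
have ZA i y : rip (Z i y) y <= rip (fcalc h (A i) y) y.
  rewrite fcalcV// -YZ; apply: opinv_antitone => //; first exact: fgt0.
  have := fXY i; rewrite XA.
  exact: (op_leP (op_gt0_is_adj (fgt0 (A0 i))) (op_gt0_is_adj (Y0 i))).1.
rewrite (DE _ _ XA) (DE _ _ YZ).
have [m [M [m0 mM Ain]]] := common_opin A0.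
have [p [P [p0 pP Zin]]] := common_opin Z0.
have B0 : op_gt0 (\sum_(i < n) adjoint (C i) * A i * D i).
  by apply/op_gt0P; exists m, M; split=> //; exact: (compression_opin DD' D1 Ain).
have G0 : op_gt0 (\sum_(i < n) adjoint (C i) * Z i * D i).
  by apply/op_gt0P; exists p, P; split=> //; exact: (compression_opin DD' D1 Zin).
split; [exact: op_gt0_opinv|exact: op_gt0_opinv|].
rewrite -fcalcE/= (opinvK B0.2).
have fB0 := fgt0 B0.
apply/op_leP; [exact: op_gt0_is_adj|exact/op_gt0_is_adj/op_gt0_opinv|].
(* The claim, f of the compression of the [A i] at most the inverse of that of the [Z i], is
   inverted into an upper bound for the compression of the [Z i]; this is Jensen's inequality
   preceded by [Z i <= h(A i)]. *)
move=> x; rewrite -[X in rip (bop_fun X x) _ <= _](opinvK fB0.2).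
apply: opinv_antitone => [||y]; [exact: G0|exact: op_gt0_opinv|].
rewrite -fcalcV// rip_compression//; apply: le_trans (jensen m0 mM Ain DD' D1 y).
by apply: ler_sum => i _; exact: ZA.
Qed.

End Jensen.

Theorem theorem2p9 (R : realType) (H : hilbertType R) (f : R -> R)
    (f_gt0 : forall x : R, 0 < x -> 0 < f x)
    (f_cont : {within `]0, +oo[%classic, continuous f}) :
  (infinite_dimensional H ->
     (operator_log_convex H f <-> cstar_log_convex (@Kset R H f))) /\
  (cstar_log_convex (@Kset R H f) -> operator_log_convex H f).
Proof.
split=> [infH|]; last exact: operator_log_convex_of_cstar.
split=> [f_lc|]; first exact: cstar_of_operator_log_convex.
exact: operator_log_convex_of_cstar.
Qed.
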